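(* Let $E_1,\dots,E_m$ be Banach lattices. The following are equivalent: (1) $E_1\hat{\otimes}_{|\pi|}\cdots\hat{\otimes}_{|\pi|}E_m$ has the positive Schur property. (2) For every Banach lattice $G$ and every $T\in\mathcal{L}^r(E_1,\dots,E_m;G)$, the linearization $T^\otimes\in\mathcal{L}^r(E_1\hat{\otimes}_{|\pi|}\cdots\hat{\otimes}_{|\pi|}E_m;G)$ is an almost Dunford–Pettis operator. (3) For every Banach lattice $G$ and every $T\in\mathcal{L}^r(E_1,\dots,E_m;G)$, there exist a Banach lattice $H$, a regular $m$-linear operator $A\in\mathcal{L}^r(E_1,\dots,E_m;H)$ and a regular almost Dunford–Pettis operator $u\in\mathcal{L}^r(H;G)$ such that $T=u\circ A$.
   Context: A Banach lattice $E$ has the positive Schur property (PSP) if every weakly null sequence of positive elements of $E$ is norm null. For Banach lattices $E_1,\dots,E_m,F$, an $m$-linear operator $T\colon E_1\times\cdots\times E_m\to F$ is positive if $T(x_1,\dots,x_m)\ge0$ whenever all $x_i\ge0$, and regular if it is the difference of two positive $m$-linear operators; $\mathcal{L}^r(E_1,\dots,E_m;F)$ denotes the space of regular (continuous) $m$-linear operators, and $\mathcal{L}^r(E;F)$ the regular linear operators. The positive projective tensor product $E_1\hat{\otimes}_{|\pi|}\cdots\hat{\otimes}_{|\pi|}E_m$ is the completion of Fremlin's vector lattice tensor product $E_1\bar{\otimes}\cdots\bar{\otimes}E_m$ under the lattice norm $\|u\|_{|\pi|}=\inf\{\sum_{k=1}^n\|x_{1,k}\|\cdots\|x_{m,k}\|: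 x_{i,k}\in E_i^+,\ |u|\le\sum_{k=1}^n x_{1,k}\otimes\cdots\otimes x_{m,k}\}$; it is a Banach lattice. For each Banach lattice $G$ and $T\in\mathcal{L}^r(E_1,\dots,E_m;G)$ there is a unique regular linear operator $T^\otimes$ on $E_1\hat{\otimes}_{|\pi|}\cdots\hat{\otimes}_{|\pi|}E_m$ with $T^\otimes(x_1\otimes\cdots\otimes x_m)=T(x_1,\dots,x_m)$ for all $x_i\in E_i$; this is the linearization of $T$. A linear operator $u\colon E\to F$ from a Banach lattice to a Banach space is almost Dunford–Pettis if $(u(x_n))_n$ is norm null for every pairwise disjoint weakly null sequence $(x_n)_n$ in $E$. *)

(* Defs.v *)
From HB Require Import structures.
From mathcomp Require Import all_boot all_order all_algebra.
From mathcomp Require Import all_classical all_reals all_analysis.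
From mathcomp Require Import Rstruct Rstruct_topology.
From Stdlib Require Import Rdefinitions.

Set Implicit Arguments.
Unset Strict Implicit.
Unset Printing Implicit Defensive.

Import Order.TTheory GRing.Theory Num.Theory.
Import numFieldNormedType.Exports.
Local Open Scope classical_set_scope.
Local Open Scope ring_scope.

Notation RR := Rdefinitions.R.

Record BanachLattice := {
  bl_car :> completeNormedModType RR;
  bl_le : bl_car -> bl_car -> Prop;
  bl_sup : bl_car -> bl_car -> bl_car;
  bl_le_refl : forall x, bl_le x x;
  bl_le_trans : forall x y z, bl_le x y -> bl_le y z -> bl_le x z;
  bl_le_anti : forall x y, bl_le x y -> bl_le y x -> x = y;
  bl_le_add : forall x y z, bl_le x y -> bl_le (x + z) (y + z);
  bl_le_scale : forall (a : RR) x y, 0 <= a -> bl_le x y -> bl_le (a *: x) (a *: y);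
  bl_sup_ubl : forall x y, bl_le x (bl_sup x y);
  bl_sup_ubr : forall x y, bl_le y (bl_sup x y);
  bl_sup_least : forall x y z, bl_le x z -> bl_le y z -> bl_le (bl_sup x y) z;
  bl_norm_mono : forall x y : bl_car,
      bl_le (bl_sup x (- x)) (bl_sup y (- y)) -> `|x| <= `|y|
}.

Arguments bl_le {b}.
Arguments bl_sup {b}.

Section BL.
Variable E : BanachLattice.

Definition bl_inf (x y : E) : E := - bl_sup (- x) (- y).
Definition bl_abs (x : E) : E := bl_sup x (- x).
Definition bl_pos (x : E) : Prop := bl_le 0 x.

End BL.

Definition is_linear (U V : lmodType RR) (f : U -> V) : Prop :=
  forall (a : RR) (x y : U), f (a *: x + y) = a *: f x + f y.

Definition weakly_null (E : BanachLattice) (x : nat -> E) : Prop :=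
  forall f : E -> RR^o, is_linear f -> continuous f ->
    (fun n => f (x n)) @ \oo --> (0 : RR).

Definition norm_null (E : normedModType RR) (x : nat -> E) : Prop :=
  (fun n => `|x n|) @ \oo --> (0 : RR).

Definition pairwise_disjoint (E : BanachLattice) (x : nat -> E) : Prop :=
  forall n k, n <> k -> bl_inf (bl_abs (x n)) (bl_abs (x k)) = 0.

Definition positive_Schur (E : BanachLattice) : Prop :=
  forall x : nat -> E, (forall n, bl_pos (x n)) -> weakly_null x -> norm_null x.

Definition almost_DP (E : BanachLattice) (F : normedModType RR) (u : E -> F) : Prop :=
  forall x : nat -> E, pairwise_disjoint x -> weakly_null x -> norm_null (fun n => u (x n)).

Definition positive_op (E F : BanachLattice) (u : E -> F) : Prop :=
  forall x, bl_pos x -> bl_pos (u x).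

Definition regular_op (E F : BanachLattice) (u : E -> F) : Prop :=
  is_linear u /\ continuous u /\
  exists p q : E -> F, [/\ is_linear p, positive_op p, is_linear q, positive_op q &
                          forall x, u x = p x - q x].

Definition dupd (m : nat) (E : 'I_m -> Type) (x : forall i, E i) (i : 'I_m) (v : E i)
  : forall j, E j :=
  fun j => match i =P j with
           | ReflectT e => eq_rect i E v j e
           | ReflectF _ => x j
           end.

Definition multilinear (m : nat) (E : 'I_m -> BanachLattice) (G : BanachLattice)
  (T : (forall i, E i) -> G) : Prop :=
  forall (x : forall i, E i) (i : 'I_m) (a : RR) (y z : E i),
    T (dupd x (a *: y + z)) = a *: T (dupd x y) + T (dupd x z).

Definition positive_multi (m : nat) (E : 'I_m -> BanachLattice) (G : BanachLattice)
  (T : (forall i, E i) -> G) : Prop :=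
  forall x : forall i, E i, (forall i, bl_pos (x i)) -> bl_pos (T x).

Definition multi_bounded_by (m : nat) (E : 'I_m -> BanachLattice) (G : BanachLattice)
  (T : (forall i, E i) -> G) (c : RR) : Prop :=
  forall x : forall i, E i, `|T x| <= c * \prod_(i < m) `|x i|.

Definition regular_multi (m : nat) (E : 'I_m -> BanachLattice) (G : BanachLattice)
  (T : (forall i, E i) -> G) : Prop :=
  multilinear T /\ (exists c, multi_bounded_by T c) /\
  exists P Q : (forall i, E i) -> G,
    [/\ multilinear P, positive_multi P, multilinear Q, positive_multi Q &
        forall x, T x = P x - Q x].

Definition op_bounded_by (E F : BanachLattice) (u : E -> F) (c : RR) : Prop :=
  forall x, `|u x| <= c * `|x|.

(* The positive projective tensor product, characterised (up to        *)
(* isometric lattice isomorphism) by Fremlin's universal property:     *)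
(* (P, tens) with tens positive m-linear, ||x_1 (x) ... (x) x_m|| <=   *)
(* prod ||x_i||, every positive continuous m-linear T into a Banach    *)
(* lattice G factors as T = T^(x) o tens with T^(x) positive linear    *)
(* continuous and ||T^(x)|| <= ||T||, and continuous linear maps on P  *)
(* are determined by their values on elementary tensors.               *)
Definition is_pos_proj_tensor (m : nat) (E : 'I_m -> BanachLattice) (P : BanachLattice)
  (tens : (forall i, E i) -> P) : Prop :=
  [/\ multilinear tens, positive_multi tens, multi_bounded_by tens 1,
      (forall (G : BanachLattice) (T : (forall i, E i) -> G),
          multilinear T -> positive_multi T -> (exists c, multi_bounded_by T c) ->
          exists L : P -> G,
            [/\ is_linear L, continuous L, positive_op L,
                (forall x, L (tens x) = T x) &
                forall c, multi_bounded_by T c -> op_bounded_by L c]) &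
      (forall (G : BanachLattice) (L1 L2 : P -> G),
          is_linear L1 -> continuous L1 -> is_linear L2 -> continuous L2 ->
          (forall x, L1 (tens x) = L2 (tens x)) -> forall z, L1 z = L2 z)].

(* Main.v *)
(** Condition (3) for [T = tens] yields a factorisation [id = u o (L1 - L2)] on the tensor
    product, with [L1, L2] positive and [u] almost Dunford-Pettis (positive multilinear maps
    between Banach lattices are automatically bounded, so the universal property applies to
    them). The heart of the matter is then that an almost Dunford-Pettis operator [u], which
    is only controlled on disjoint sequences, sends every bounded positive weakly null
    sequence [x] to a norm null one.

    Work with the lattice seminorm [q x = sup {|u y| : 0 <= y <= x}]. Disjointification shows
    that, up to a [q]-small error, [x] lies in an order interval [[0, w]]. Order bounded
    disjoint sequences are weakly null, hence [q]-null, and from this order bounded monotone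
    sequences are [q]-Cauchy. If a weakly null sequence in [[0, w]] were not [q]-null, take
    Hahn-Banach functionals [phi_n <= q] norming its terms and a subsequence on which
    [phi_j x_i] decays rapidly for [i > j]; the decreasing sequence of tails
    [sup_{i >= k} x_i] (finite suprema and infima suffice, up to small errors) then has steps
    that [phi_k] keeps bounded away from [0], a contradiction.

    Conversely, for a disjoint weakly null sequence [x] the sequence [|x|] is weakly null: a
    functional can be cut down to the ideal generated by the positive parts [x_n^+]. Hence the
    positive Schur property makes every continuous operator almost Dunford-Pettis. *)

Require Import Defs.
From mathcomp Require Import all_boot all_order all_algebra.
From mathcomp Require Import all_classical all_reals all_analysis.
From mathcomp Require Import Rstruct Rstruct_topology.
From mathcomp Require Import ring lra zify.

Set Implicit Arguments.
Unset Strict Implicit.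
Unset Printing Implicit Defensive.

Import Order.TTheory GRing.Theory Num.Theory.
Import numFieldNormedType.Exports.
Local Open Scope classical_set_scope.
Local Open Scope ring_scope.

(** * A reflexive procedure for linear identities in modules *)

Inductive mexpr : Type :=
| MVar of nat | MZero | MAdd of mexpr & mexpr | MOpp of mexpr | MScale of RR & mexpr.

Fixpoint meval (V : lmodType RR) (env : seq V) (e : mexpr) : V :=
  match e with
  | MVar n => nth 0 env n
  | MZero => 0
  | MAdd a b => meval env a + meval env b
  | MOpp a => - meval env a
  | MScale c a => c *: meval env a
  end.

Fixpoint mcoef (e : mexpr) (i : nat) : RR :=
  match e with
  | MVar n => if eqn n i then 1 else 0
  | MZero => 0
  | MAdd a b => mcoef a i + mcoef b i
  | MOpp a => - mcoef a i
  | MScale c a => c * mcoef a i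
  end.

Lemma mevalE (V : lmodType RR) (env : seq V) (e : mexpr) :
  meval env e = \sum_(i < size env) mcoef e i *: env`_i.
Proof.
elim: e => /= [n||a -> b ->|a ->|c a ->].
- have [nlt|nge] := ltnP n (size env).
    rewrite (bigD1 (Ordinal nlt)) //= (introT eqnP (erefl n)) scale1r big1 ?addr0 // => i.
    move=> /negP ine; case: (@eqnP n i) => [ni|]; last by rewrite scale0r.
    by exfalso; apply: ine; apply/eqP/val_inj.
  rewrite nth_default // big1 // => i _; case: (@eqnP n i) => [ni|].
    by have := ltn_ord i; rewrite -ni ltnNge nge.
  by rewrite scale0r.
- by rewrite big1 // => i _; rewrite scale0r.
- by rewrite -big_split; apply: eq_bigr => i _; rewrite scalerDl.
- by rewrite -sumrN; apply: eq_bigr => i _; rewrite scaleNr.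
- by rewrite scaler_sumr; apply: eq_bigr => i _; rewrite scalerA.
Qed.

(** A nested conjunction instead of a quantified statement: for a concrete number of atoms it
    reduces to one scalar identity per atom, which [ring] or [field] can settle. *)
Fixpoint mcoef_eq (n : nat) (e1 e2 : mexpr) : Prop :=
  if n is n'.+1 then mcoef e1 n' = mcoef e2 n' /\ mcoef_eq n' e1 e2 else True.

Lemma module_correct (V : lmodType RR) (env : seq V) (e1 e2 : mexpr) :
  mcoef_eq (size env) e1 e2 -> meval env e1 = meval env e2.
Proof.
move=> h; rewrite !mevalE; apply: eq_bigr => i _; congr (_ *: _).
elim: (size env) i h => [[] //|n IH] i [hn h].
have [lt_in|] := ltnP i n; first exact: (IH (Ordinal lt_in)).
by move=> le_ni; have -> : i = n :> nat by apply/eqP; rewrite eqn_leq le_ni -ltnS ltn_ord.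
Qed.

(** Atoms are compared up to unification rather than syntactically, so that convertible forms of one
    vector share an index. *)
Ltac mod_index x env :=
  lazymatch env with
  | ?y :: ?t =>
    match goal with
    | _ => let _ := match goal with _ => unify x y end in constr:(O)
    | _ => let n := mod_index x t in constr:(S n)
    end
  end.

Ltac mod_mem x env :=
  match goal with
  | _ => let _ := mod_index x env in constr:(true)
  | _ => constr:(false)
  end.

Ltac mod_atoms t env :=
  lazymatch t with
  | (?a + ?b)%R => let e := mod_atoms a env in mod_atoms b e
  | (- ?a)%R => mod_atoms a env
  | (_ *: ?a)%R => mod_atoms a env
  | 0%R => env
  | _ => lazymatch mod_mem t env with true => env | false => constr:(t :: env) end
  end.

Ltac mod_reify t env :=
  lazymatch t with
  | (?a + ?b)%R => let u := mod_reify a env in let v := mod_reify b env in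
                   constr:(MAdd u v)
  | (- ?a)%R => let u := mod_reify a env in constr:(MOpp u)
  | (?c *: ?a)%R => let u := mod_reify a env in constr:(MScale c u)
  | 0%R => constr:(MZero)
  | _ => let n := mod_index t env in constr:(MVar n)
  end.

Ltac module :=
  lazymatch goal with
  | |- @eq ?T ?s ?t =>
    let env0 := mod_atoms s (@nil T) in
    let env := mod_atoms t env0 in
    let e1 := mod_reify s env in
    let e2 := mod_reify t env in
    apply: (@module_correct _ env e1 e2);
    cbn [mcoef_eq mcoef size eqn]; repeat (split; first by first [ring | field]); exact: I
  end.

Local Notation "x <=: y" := (bl_le x y) (at level 70, no associativity).

(** The positive part $x^+$; the negative part is written [bl_pp (- x)]. *)
Definition bl_pp (E : BanachLattice) (x : E) : E := bl_sup x 0.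

(** * Vector lattice identities *)

Section Riesz.
Variable E : BanachLattice.
Implicit Types x y z u v w a b : E.

Lemma bl_lexx x : x <=: x. Proof. exact: bl_le_refl. Qed.
Hint Resolve bl_lexx : core.

(** The order is translation invariant, so an inequality depends only on the difference of its
    sides. This reduces most order goals below to a known inequality and a linear identity for
    [module]. *)
Lemma bl_le_of_sub a b x y : a <=: b -> y - x = b - a -> x <=: y.
Proof.
move=> ab e; have := bl_le_add (x - a) ab.
have -> : a + (x - a) = x by module.
suff -> : b + (x - a) = y by [].
have -> : b + (x - a) = (b - a) + x by module.
by rewrite -e; module.
Qed.

Lemma bl_leD x y z w : x <=: y -> z <=: w -> x + z <=: y + w.
Proof.
move=> xy zw; apply: bl_le_trans (bl_le_add z xy) _.
by rewrite ![y + _]addrC; apply: bl_le_add.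
Qed.

Lemma bl_leN x y : x <=: y -> - y <=: - x.
Proof. by move/bl_le_of_sub; apply; module. Qed.

Lemma bl_subr_ge0 x y : bl_pos (y - x) <-> x <=: y.
Proof. by split=> /bl_le_of_sub; apply; module. Qed.

Lemma bl_posD x y : bl_pos x -> bl_pos y -> bl_pos (x + y).
Proof. by move=> px py; have := bl_leD px py; rewrite addr0. Qed.

Lemma bl_leDr x y : bl_pos y -> x <=: x + y.
Proof. by move/bl_le_of_sub; apply; module. Qed.

Lemma bl_leDl x y : bl_pos y -> x <=: y + x.
Proof. by move/bl_le_of_sub; apply; module. Qed.

Lemma bl_posZ (c : RR) x : 0 <= c -> bl_pos x -> bl_pos (c *: x).
Proof. by move=> c0 px; have := bl_le_scale c0 px; rewrite scaler0. Qed.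

Lemma bl_leZr (c d : RR) x : bl_pos x -> c <= d -> c *: x <=: d *: x.
Proof.
move=> px cd; apply/bl_subr_ge0; have -> : d *: x - c *: x = (d - c) *: x by module.
by apply: bl_posZ => //; lra.
Qed.

Lemma bl_pos0 : bl_pos (0 : E). Proof. exact: bl_lexx. Qed.
Hint Resolve bl_pos0 : core.

Lemma bl_pos_sum (I : Type) (s : seq I) (F : I -> E) (Q : pred I) :
  (forall i, bl_pos (F i)) -> bl_pos (\sum_(i <- s | Q i) F i).
Proof. by move=> h; apply: big_ind => //; exact: bl_posD. Qed.

Lemma bl_infl x y : bl_inf x y <=: x.
Proof. by apply: (bl_le_of_sub (bl_sup_ubl (- x) (- y))); rewrite /bl_inf; module. Qed.

Lemma bl_infr x y : bl_inf x y <=: y.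
Proof. by apply: (bl_le_of_sub (bl_sup_ubr (- x) (- y))); rewrite /bl_inf; module. Qed.

Lemma bl_inf_greatest x y z : z <=: x -> z <=: y -> z <=: bl_inf x y.
Proof.
move=> zx zy; apply: (bl_le_of_sub (bl_sup_least (bl_leN zx) (bl_leN zy))).
by rewrite /bl_inf; module.
Qed.

Lemma bl_inf_pos x y : bl_pos x -> bl_pos y -> bl_pos (bl_inf x y).
Proof. exact: bl_inf_greatest. Qed.

Lemma bl_infC x y : bl_inf x y = bl_inf y x.
Proof.
by apply: bl_le_anti; apply: bl_inf_greatest; (exact: bl_infl || exact: bl_infr).
Qed.

Lemma bl_inf_le2 x y z w : x <=: z -> y <=: w -> bl_inf x y <=: bl_inf z w.
Proof.
move=> xz yw; apply: bl_inf_greatest.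
  exact: bl_le_trans (bl_infl _ _) xz.
exact: bl_le_trans (bl_infr _ _) yw.
Qed.

Lemma bl_sup_le2 x y z w : x <=: z -> y <=: w -> bl_sup x y <=: bl_sup z w.
Proof.
move=> xz yw; apply: bl_sup_least.
  exact: bl_le_trans xz (bl_sup_ubl _ _).
exact: bl_le_trans yw (bl_sup_ubr _ _).
Qed.

Lemma bl_supD x y z : bl_sup (x + z) (y + z) = bl_sup x y + z.
Proof.
apply: bl_le_anti.
  by apply: bl_sup_least; apply: bl_leD => //; (exact: bl_sup_ubl || exact: bl_sup_ubr).
have h : bl_sup x y <=: bl_sup (x + z) (y + z) - z.
  apply: bl_sup_least.
    by apply: (bl_le_of_sub (bl_sup_ubl (x + z) (y + z))); module.
  by apply: (bl_le_of_sub (bl_sup_ubr (x + z) (y + z))); module.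
by apply: (bl_le_of_sub h); module.
Qed.

Lemma bl_supC x y : bl_sup x y = bl_sup y x.
Proof.
by apply: bl_le_anti; apply: bl_sup_least; (exact: bl_sup_ubl || exact: bl_sup_ubr).
Qed.

Lemma bl_supZ (c : RR) x y : 0 < c -> bl_sup (c *: x) (c *: y) = c *: bl_sup x y.
Proof.
move=> c0; have c0' := ltW c0; apply: bl_le_anti.
  by apply: bl_sup_least; apply: bl_le_scale => //; (exact: bl_sup_ubl || exact: bl_sup_ubr).
have ci : 0 <= c^-1 by rewrite invr_ge0.
have cK z : z = c^-1 *: (c *: z) by rewrite scalerA mulVf ?scale1r // gt_eqF.
have h : bl_sup x y <=: c^-1 *: bl_sup (c *: x) (c *: y).
  apply: bl_sup_least.
    by rewrite {1}[x]cK; apply: bl_le_scale => //; exact: bl_sup_ubl.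
  by rewrite {1}[y]cK; apply: bl_le_scale => //; exact: bl_sup_ubr.
have := bl_le_scale c0' h.
by rewrite scalerA mulfV ?scale1r // gt_eqF.
Qed.

Lemma bl_infZ (c : RR) x y : 0 < c -> bl_inf (c *: x) (c *: y) = c *: bl_inf x y.
Proof. by move=> c0; rewrite /bl_inf -!scalerN bl_supZ // scalerN. Qed.

Lemma bl_pp_pos x : bl_pos (bl_pp x). Proof. exact: bl_sup_ubr. Qed.
Hint Resolve bl_pp_pos : core.

Lemma bl_pp_ge x : x <=: bl_pp x. Proof. exact: bl_sup_ubl. Qed.

Lemma bl_pp_least x y : x <=: y -> bl_pos y -> bl_pp x <=: y.
Proof. exact: bl_sup_least. Qed.

Lemma bl_pp_le x y : x <=: y -> bl_pp x <=: bl_pp y.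
Proof. by move=> xy; exact: bl_sup_le2. Qed.

Lemma bl_pp_id x : bl_pos x -> bl_pp x = x.
Proof. by move=> px; apply: bl_le_anti; [exact: bl_pp_least | exact: bl_pp_ge]. Qed.

Lemma bl_pp_eq0 x : x <=: 0 -> bl_pp x = 0.
Proof. by move=> x0; apply: bl_le_anti; [exact: bl_pp_least | exact: bl_pp_pos]. Qed.

Lemma bl_ppZ (c : RR) x : 0 <= c -> bl_pp (c *: x) = c *: bl_pp x.
Proof.
rewrite le_eqVlt => /orP[/eqP<-|c0]; first by rewrite !scale0r bl_pp_id.
by rewrite /bl_pp -bl_supZ // scaler0.
Qed.

(** Translating $(-x) \vee (-y)$ by $x$ gives $(x - y)^+$. This splits a positive $x$ into a part
    below $y$ and an excess, the basic truncation of the whole development. *)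
Lemma bl_pp_inf x y : bl_pp (x - y) + bl_inf x y = x.
Proof.
have -> : bl_pp (x - y) = bl_sup (- x) (- y) + x.
  by rewrite -bl_supD bl_supC /bl_pp; congr (bl_sup _ _); module.
by rewrite /bl_inf; module.
Qed.

Lemma bl_infE x y : bl_inf x y = x - bl_pp (x - y).
Proof. by rewrite -{2}(bl_pp_inf x y); module. Qed.

Lemma bl_pp_subN x : bl_pp x - bl_pp (- x) = x.
Proof.
have -> : bl_pp (- x) = bl_pp x - x.
  by rewrite /bl_pp -bl_supD bl_supC; congr (bl_sup _ _); module.
by module.
Qed.

Lemma bl_ppN x : bl_pp (- x) = bl_pp x - x.
Proof. by rewrite -{3}(bl_pp_subN x); module. Qed.

(** Translation by $x$ shows $|x| = (2x) \vee 0 - x = 2x^+ - x$. *)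
Lemma bl_absE x : bl_abs x = bl_pp x + bl_pp (- x).
Proof.
have -> : bl_abs x = 2 *: bl_pp x - x.
  rewrite /bl_pp -bl_supZ ?ltr0n // -bl_supD /bl_abs.
  by congr (bl_sup _ _); module.
by rewrite bl_ppN; module.
Qed.

Lemma bl_inf_ppN x : bl_inf (bl_pp x) (bl_pp (- x)) = 0.
Proof. by rewrite bl_infE bl_pp_subN; module. Qed.

Lemma bl_abs_pos x : bl_pos (bl_abs x).
Proof. by rewrite bl_absE; exact: bl_posD. Qed.

Lemma bl_absN x : bl_abs (- x) = bl_abs x.
Proof. by rewrite /bl_abs opprK bl_supC. Qed.

Lemma bl_abs_id x : bl_pos x -> bl_abs x = x.
Proof.
move=> px; apply: bl_le_anti; last exact: bl_sup_ubl.
have nx : - x <=: 0 by apply: (bl_le_of_sub px); module.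
by apply: bl_sup_least => //; exact: bl_le_trans nx px.
Qed.

Lemma bl_abs_ge x : x <=: bl_abs x. Proof. exact: bl_sup_ubl. Qed.

Lemma bl_pp_abs x : bl_pp x <=: bl_abs x.
Proof. by apply: bl_pp_least; [exact: bl_abs_ge | exact: bl_abs_pos]. Qed.

Lemma bl_inf_sub_additive x y z : bl_pos x -> bl_pos y -> bl_pos z ->
  bl_inf x (y + z) <=: bl_inf x y + bl_inf x z.
Proof.
move=> px py pz; set w := bl_inf x (y + z).
have wx : w <=: x by exact: bl_infl.
have h : w - bl_inf x z <=: bl_inf x y.
  apply: bl_inf_greatest.
    by apply: (bl_le_of_sub (bl_leD wx (bl_inf_pos px pz))); module.
  have hz : w - y <=: bl_inf x z.
    apply: bl_inf_greatest; first by apply: (bl_le_of_sub (bl_leD wx py)); module.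
    by apply: (bl_le_of_sub (bl_infr x (y + z))); rewrite /w; module.
  by apply: (bl_le_of_sub hz); module.
by apply: (bl_le_of_sub h); module.
Qed.

Lemma bl_inf_sum x (I : Type) (s : seq I) (Q : pred I) (F : I -> E) : bl_pos x ->
  (forall i, bl_pos (F i)) ->
  bl_inf x (\sum_(i <- s | Q i) F i) <=: \sum_(i <- s | Q i) bl_inf x (F i).
Proof.
move=> px pF; elim: s => [|i s IH]; first by rewrite !big_nil; exact: bl_infr.
rewrite !big_cons; case: (Q i) => //.
apply: bl_le_trans (bl_inf_sub_additive _ _ _) _ => //; first exact: bl_pos_sum.
exact: bl_leD.
Qed.

Lemma bl_inf_scale_le (c : RR) x y : 1 <= c -> bl_pos x ->
  bl_inf x (c *: y) <=: c *: bl_inf x y.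
Proof.
move=> c1 px; rewrite -bl_infZ; last by lra.
by apply: bl_inf_le2 => //; rewrite -{1}[x]scale1r; exact: bl_leZr.
Qed.

Lemma bl_inf_disj_le x y a b : bl_pos x -> bl_pos y -> x <=: a -> y <=: b ->
  bl_inf a b = 0 -> bl_inf x y = 0.
Proof.
move=> px py xa yb e; apply: bl_le_anti; last exact: bl_inf_pos.
by rewrite -e; exact: bl_inf_le2.
Qed.

(** For disjoint vectors the sum is the supremum, because $x \wedge y = 0$ gives $(x - y)^+ = x$. *)
Lemma bl_disj_add_le x y u : bl_inf x y = 0 -> x <=: u -> y <=: u -> x + y <=: u.
Proof.
move=> e xu yu; have := bl_pp_inf x y; rewrite e addr0 => h.
have -> : x + y = bl_sup x y.
  rewrite -{1}h /bl_pp -bl_supD; congr (bl_sup _ _); module.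
exact: bl_sup_least.
Qed.

(** With $k = a \vee b - w \ge 0$, both $a - k$ and $b - k$ lie below $w$ and hence below $c$.
    Taking the supremum of $a - k \le a \wedge c$ and $b - k \le b \wedge c$ recovers $w$ on the
    left. *)
Lemma bl_distr w a b c : w <=: bl_sup a b -> w <=: c ->
  w <=: bl_sup (bl_inf a c) (bl_inf b c).
Proof.
move=> wab wc; pose k := bl_sup a b - w.
have h x : x <=: bl_sup a b -> x - k <=: bl_inf x c.
  move=> xab; apply: bl_inf_greatest.
    by apply: (bl_le_of_sub wab); rewrite /k; module.
  by apply: bl_le_trans wc; apply: (bl_le_of_sub xab); rewrite /k; module.
have := bl_sup_le2 (h _ (bl_sup_ubl a b)) (h _ (bl_sup_ubr a b)).
by rewrite bl_supD; apply: bl_le_trans; apply: (bl_le_of_sub (bl_lexx 0)); rewrite /k; module.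
Qed.

Lemma bl_le_pp_inf z a b : z <=: bl_pp a -> z <=: bl_pp b -> z <=: bl_pp (bl_inf a b).
Proof.
move=> za zb; apply: bl_le_trans (bl_distr za zb) _.
apply: bl_sup_least; last exact: bl_le_trans (bl_infl _ _) (bl_pp_pos _).
apply: bl_le_trans (bl_distr (bl_infr _ _) (bl_infl _ _)) _.
by apply: bl_sup_le2; [rewrite bl_infC | exact: bl_infl].
Qed.

(** Since $c(b - da) \le cb - a$, the second vector lies below the negative part of $a - cb$, which
    is disjoint from its positive part. *)
Lemma bl_inf_pp_sub a b (c d : RR) : bl_pos a -> bl_pos b -> 1 <= c -> 1 <= c * d ->
  bl_inf (bl_pp (a - c *: b)) (bl_pp (b - d *: a)) = 0.
Proof.
move=> pa pb c1 cd; have c0 : 0 < c by lra.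
apply: bl_inf_disj_le (bl_lexx _) _ (bl_inf_ppN (a - c *: b)) => //.
apply: (@bl_le_trans _ _ (bl_pp (c *: (b - d *: a)))).
  by rewrite bl_ppZ ?ltW // -{1}[bl_pp (b - _)]scale1r; exact: bl_leZr.
apply: bl_pp_le; apply: (bl_le_of_sub (bl_leZr pa cd)); module.
Qed.

Lemma riesz_decomposition v x y : bl_pos v -> bl_pos x -> bl_pos y -> v <=: x + y ->
  [/\ bl_pos (bl_inf v x), bl_inf v x <=: x, bl_pos (bl_pp (v - x)),
      bl_pp (v - x) <=: y & v = bl_inf v x + bl_pp (v - x)].
Proof.
move=> pv px py vxy; split=> //; first exact: bl_inf_pos.
- exact: bl_infr.
- by apply: bl_pp_least => //; apply: (bl_le_of_sub vxy); module.
- by rewrite addrC bl_pp_inf.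
Qed.

Lemma bl_norm_le x y : bl_pos x -> x <=: y -> `|x| <= `|y|.
Proof.
move=> px xy; apply: bl_norm_mono; rewrite -!/(bl_abs _) !bl_abs_id //.
exact: bl_le_trans xy.
Qed.

Lemma bl_norm_abs x : `|bl_abs x| = `|x|.
Proof.
have e : bl_abs (bl_abs x) = bl_abs x by rewrite bl_abs_id //; exact: bl_abs_pos.
by apply/eqP; rewrite eq_le; apply/andP; split; apply: bl_norm_mono;
  rewrite -!/(bl_abs _) e.
Qed.

Lemma bl_norm_pp x : `|bl_pp x| <= `|x|.
Proof. by rewrite -(bl_norm_abs x); apply: bl_norm_le => //; exact: bl_pp_abs. Qed.

(** The positive cone is closed: $y_n \ge 0$ gives $(-l)^+ \le (y_n - l)^+$, so the norm of $(-l)^+$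
    is at most the distance from $y_n$ to $l$. *)
Lemma bl_limit_pos (y : nat -> E) (l : E) : y @ \oo --> l ->
  (exists N, forall n, (N <= n)%N -> bl_pos (y n)) -> bl_pos l.
Proof.
move=> yl [N py]; suff e : bl_pp (- l) = 0.
  by rewrite -(bl_pp_subN l) e subr0.
apply/eqP; rewrite -normr_eq0 eq_le normr_ge0 andbT.
apply/ler_addgt0Pr => e e0; rewrite add0r.
have /cvgrPdist_lt /(_ e e0) [M _ hM] := yl.
apply: le_trans (ltW (hM (maxn N M) (leq_maxr _ _))).
have -> : `|l - y (maxn N M)| = `|y (maxn N M) - l| by rewrite distrC.
apply: le_trans (bl_norm_pp _); apply: bl_norm_le => //; apply: bl_pp_le.
by apply: (bl_le_of_sub (py _ (leq_maxl N M))); module.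
Qed.

(* This is the only place where completeness of the norm enters. *)
Lemma bl_dominating (b : nat -> E) (M : RR) : (forall n, bl_pos (b n)) ->
  (forall n, `|b n| <= M * (2^-1) ^+ n) -> exists x, forall n, b n <=: x.
Proof.
move=> pb nb.
have cs : cvgn (series b).
  apply: normed_cvg.
  apply: (@series_le_cvg _ _ (geometric M 2^-1)) => [n|n|n|] //=.
  - exact: le_trans (normr_ge0 _) (nb n).
  - by apply: is_cvg_geometric_series; rewrite ger0_norm; lra.
exists (limn (series b)) => n; apply/bl_subr_ge0.
apply: (@bl_limit_pos (fun k => series b k - b n)).
  by apply: cvgB => //; exact: cvg_cst.
exists n.+1 => k nk; rewrite /series /= big_mkord (bigD1 (Ordinal nk)) //=.
have -> (s : E) : b n + s - b n = s by module.
exact: bl_pos_sum.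
Qed.

End Riesz.

(** * Hahn-Banach *)

Section HahnBanach.
Variables (V : lmodType RR) (p : V -> RR) (w : V).
Hypothesis pD : forall x y, p (x + y) <= p x + p y.
Hypothesis pZ : forall c x, 0 <= c -> p (c *: x) = c * p x.

Let p0 : p 0 = 0. Proof. by rewrite -(scale0r (0 : V)) pZ // mul0r. Qed.

(** Graphs of linear functionals dominated by [p] and normed at [w]. The last clause is conditional
    so that the empty set, the union of the empty chain, qualifies; single-valuedness will follow
    from domination. *)
Let good (A : set (V * RR)) :=
  [/\ (forall a u v, A u -> A v -> A (a *: u.1 + v.1, a * u.2 + v.2)),
      (forall u, A u -> u.2 <= p u.1) & (forall u, A u -> A (w, p w))].

Let good_bigcup (F : set (set (V * RR))) :
  F `<=` good -> total_on F subset -> good (\bigcup_(X in F) X).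
Proof.
move=> Fg Ft; split.
- move=> a u v [X FX Xu] [Y FY Yv].
  have [XY|YX] := Ft _ _ FX FY.
    by exists Y => //; have [h _ _] := Fg _ FY; apply: h => //; exact: XY.
  by exists X => //; have [h _ _] := Fg _ FX; apply: h => //; exact: YX.
- by move=> u [X FX Xu]; have [_ h _] := Fg _ FX; exact: h.
- by move=> u [X FX Xu]; have [_ _ h] := Fg _ FX; exists X => //; exact: h Xu.
Qed.

Let good_line : good [set u | exists t, u = (t *: w, t * p w)].
Proof.
split.
- move=> a u v [t ->] [s ->]; exists (a * t + s) => /=.
  by congr (_, _); [module | ring].
- move=> u [t ->] /=; have [t0|t0] := leP 0 t; first by rewrite pZ.
  have : 0 <= p (t *: w) + p (- t *: w).
    by rewrite -p0; apply: le_trans (pD _ _); rewrite -scalerDl subrr scale0r.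
  by rewrite (pZ w (_ : 0 <= - t)); lra.
- by move=> _ _; exists 1; rewrite scale1r mul1r.
Qed.

(** The value at [v] must lie between the numbers [u.2 - p (u.1 - v)] and [p (u.1 + v) - u.2].
    Subadditivity separates the two families, so the supremum of the first one works; homogeneity
    reduces a general multiple of [v] to these two bounds. *)
Let good_extend (A : set (V * RR)) (v : V) : good A -> A (w, p w) ->
  exists c, good [set u | exists x t, A x /\ u = (x.1 + t *: v, x.2 + t * c)].
Proof.
move=> [Al Ap Aw] Aw0.
have A0 : A (0, 0).
  by have := Al (-1) _ _ Aw0 Aw0; rewrite /= scaleN1r addNr mulN1r addNr.
have AZ a u : A u -> A (a *: u.1, a * u.2).
  by move=> Au; have := Al a _ _ Au A0; rewrite /= !addr0.
pose S := [set r | exists2 u, A u & r = u.2 - p (u.1 - v)].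
have Sub u : A u -> ubound S (p (u.1 + v) - u.2).
  move=> Au _ [y Ay ->].
  have := Ap _ (Al 1 _ _ Au Ay); rewrite /= scale1r mul1r => h.
  have := pD (u.1 + v) (y.1 - v).
  have -> : u.1 + v + (y.1 - v) = u.1 + y.1 by module.
  lra.
exists (sup S).
have S0 : S !=set0 by exists (0 - p (0 - v)); exists (0, 0).
have cle u : A u -> sup S <= p (u.1 + v) - u.2 by move=> Au; apply: ge_sup => //; exact: Sub.
have cge u : A u -> u.2 - p (u.1 - v) <= sup S.
  move=> Au; apply: ub_le_sup; last by exists u.
  by exists (p (0 + v) - 0); exact: (Sub (0, 0)).
split.
- move=> a _ _ [x [t [Ax ->]]] [y [s [Ay ->]]] /=.
  exists (a *: x.1 + y.1, a * x.2 + y.2), (a * t + s); split; first exact: Al.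
  by congr (_, _) => /=; [module | ring].
- move=> _ [x [t [Ax ->]]] /=.
  have [t0|t0|<-] := ltgtP 0 t; last by rewrite scale0r mul0r !addr0; exact: Ap.
    have := cle _ (AZ t^-1 _ Ax) => /= h.
    have e : t * p (t^-1 *: x.1 + v) = p (x.1 + t *: v).
      by rewrite -pZ ?ltW // scalerDr scalerA mulfV ?gt_eqF // scale1r.
    rewrite -e -subr_ge0.
    have -> : t * p (t^-1 *: x.1 + v) - (x.2 + t * sup S) =
              t * (p (t^-1 *: x.1 + v) - t^-1 * x.2 - sup S).
      by field; rewrite gt_eqF.
    by apply: mulr_ge0; lra.
  have s0 : 0 < - t by lra.
  have := cge _ (AZ (- t)^-1 _ Ax) => /= h.
  have e : (- t) * p ((- t)^-1 *: x.1 - v) = p (x.1 + t *: v).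
    rewrite -pZ ?ltW // scalerBr scalerA mulfV ?gt_eqF // scale1r; congr p; module.
  rewrite -e -subr_ge0.
  have -> : (- t) * p ((- t)^-1 *: x.1 - v) - (x.2 + t * sup S) =
            (- t) * (sup S - ((- t)^-1 * x.2 - p ((- t)^-1 *: x.1 - v))).
    by field; rewrite lt_eqF.
  by apply: mulr_ge0; lra.
- by move=> _ _; exists (w, p w), 0; rewrite scale0r mul0r !addr0.
Qed.

Theorem hahn_banach : exists f : V -> RR,
  [/\ forall a x y, f (a *: x + y) = a * f x + f y,
      forall x, f x <= p x & f w = p w].
Proof.
have [A [Ag Amax]] := Zorn_bigcup good_bigcup.
have [Al Ap Aw] := Ag.
have Aw0 : A (w, p w).
  (* A good set that misses this point is empty, and the line through the point properly contains
     it. *)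
  have [//|nA] := pselect (A (w, p w)).
  exfalso; apply: (Amax _ _ good_line); split.
    by move=> u Au; case: nA; exact: Aw Au.
  by move=> /(_ (w, p w)); apply: contra_not nA; apply; exists 1; rewrite scale1r mul1r.
have A0 : A (0, 0).
  by have := Al (-1) _ _ Aw0 Aw0; rewrite /= scaleN1r addNr mulN1r addNr.
have tot v : exists r, A (v, r).
  have [c gB] := good_extend v Ag Aw0.
  have [//|nA] := pselect (exists r, A (v, r)).
  exfalso; apply: (Amax _ _ gB); split.
    by move=> u Au; exists u, 0; rewrite scale0r mul0r !addr0 -surjective_pairing.
  move=> /(_ (v, c)); apply: contra_not nA => h; exists c; apply: h.
  by exists (0, 0), 1; rewrite /= scale1r mul1r !add0r.
(* The difference of two values over [x] is a value over 0, at most [p 0 = 0], in either order. *)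
have fct x r s : A (x, r) -> A (x, s) -> r = s.
  have h0 r' s' : A (x, r') -> A (x, s') -> r' <= s'.
    move=> Ar As; have := Ap _ (Al (-1) _ _ As Ar).
    by rewrite /= scaleN1r addNr p0; lra.
  by move=> Ar As; apply/eqP; rewrite eq_le !h0.
have [f fA] := choice tot.
exists f; split=> [a x y|x|].
- exact: fct (fA _) (Al a _ _ (fA x) (fA y)).
- exact: Ap _ (fA x).
- exact: fct (fA w) Aw0.
Qed.

End HahnBanach.

(** * Null sequences *)

Definition null_seq (a : nat -> RR) : Prop :=
  forall e : RR, 0 < e -> exists N, forall n, (N <= n)%N -> `|a n| < e.

Lemma null_seqP (a : nat -> RR) : a @ \oo --> (0 : RR) <-> null_seq a.
Proof.
split=> h.
  move=> e e0; have [N _ hN] := (@cvgrPdist_lt RR RR^o nat \oo _ a 0).1 h e e0.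
  by exists N => n Nn; have := hN n Nn; rewrite /= sub0r normrN.
apply: (@cvgrPdist_lt RR RR^o nat \oo _ a 0).2 => e e0; have [N hN] := h e e0.
by exists N => // n /= Nn; rewrite sub0r normrN; exact: hN.
Qed.

Lemma null_seq_le (a b : nat -> RR) : (forall n, `|a n| <= b n) -> null_seq b -> null_seq a.
Proof.
move=> ab hb e e0; have [N hN] := hb e e0; exists N => n Nn.
by apply: le_lt_trans (ab n) _; apply: le_lt_trans (ler_norm _) (hN n Nn).
Qed.

Lemma null_seq_norm (a : nat -> RR) : null_seq a -> null_seq (fun n => `|a n|).
Proof. by move=> ha e /ha[N hN]; exists N => n /hN; rewrite normr_id. Qed.

Lemma null_seqD (a b : nat -> RR) : null_seq a -> null_seq b -> null_seq (fun n => a n + b n).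
Proof.
move=> ha hb e e0; have e2 : 0 < e / 2 by lra.
have [N hN] := ha _ e2; have [M hM] := hb _ e2; exists (maxn N M) => n.
rewrite geq_max => /andP[/hN hn /hM hm].
by apply: le_lt_trans (ler_normD _ _) _; lra.
Qed.

Lemma null_seqZ (c : RR) (a : nat -> RR) : null_seq a -> null_seq (fun n => c * a n).
Proof.
move=> ha e e0; have c1 : 0 < `|c| + 1 by have := normr_ge0 c; lra.
have [N hN] := ha _ (divr_gt0 e0 c1); exists N => n /hN.
rewrite ltr_pdivlMr // normrM => h; have := normr_ge0 (a n); nra.
Qed.

Lemma null_seq_sum (N : nat) (a : nat -> nat -> RR) : (forall i, null_seq (a i)) ->
  null_seq (fun n => \sum_(i < N) a i n).
Proof.
move=> ha; elim: N => [|N IH].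
  by move=> e e0; exists 0%N => n _; rewrite big_ord0 normr0.
move=> e e0; have [M hM] := null_seqD IH (ha N) e0; exists M => n Mn.
by rewrite big_ord_recr; exact: hM.
Qed.

Lemma null_seq_sub (s : nat -> nat) (a : nat -> RR) : (forall n, (n <= s n)%N) ->
  null_seq a -> null_seq (fun n => a (s n)).
Proof.
move=> hs ha e e0; have [N hN] := ha e e0; exists N => n Nn.
by apply: hN; exact: leq_trans Nn (hs n).
Qed.

Lemma not_null_seq (a : nat -> RR) : (forall n, 0 <= a n) -> ~ null_seq a ->
  exists2 e : RR, 0 < e & forall N, exists2 n, (N < n)%N & e <= a n.
Proof.
move=> a0 na; apply: contrapT => h; apply: na => e e0.
apply: contrapT => h'; apply: h; exists e => // N.
apply: contrapT => h''; apply: h'; exists N.+1 => n Nn.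
rewrite ger0_norm // ltNge; apply/negP => an; apply: h''.
by exists n.
Qed.

Lemma extract (Q : nat -> nat -> Prop) : (forall N, exists2 n, (N < n)%N & Q N n) ->
  forall n0, exists s : nat -> nat,
    [/\ s 0%N = n0, forall i j, (i < j)%N -> (s i < s j)%N, forall n, (n <= s n)%N
      & forall k, Q (s k) (s k.+1)].
Proof.
move=> h n0.
have ex N : exists n, (N < n)%N /\ Q N n by have [n Nn QNn] := h N; exists n.
have [F hF] := choice ex.
exists (fun k => iter k F n0).
have lt i j : (i < j)%N -> (iter i F n0 < iter j F n0)%N.
  elim: j => // j IH; rewrite ltnS leq_eqVlt => /orP[/eqP->|/IH ij].
    by have [] := hF (iter j F n0).
  by apply: ltn_trans ij _; have [] := hF (iter j F n0).
split=> // [n|k]; last by have [] := hF (iter k F n0).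
by elim: n => // n IH; apply: leq_ltn_trans IH (lt _ _ (ltnSn n)).
Qed.

Lemma half_pow_gt0 n : 0 < (2^-1 : RR) ^+ n.
Proof. by apply: exprn_gt0; lra. Qed.

Lemma half_pow_ge0 n : 0 <= (2^-1 : RR) ^+ n.
Proof. exact: ltW (half_pow_gt0 n). Qed.

Lemma half_pow_null : null_seq (fun n => (2^-1 : RR) ^+ n).
Proof.
apply/null_seqP; have := @cvg_geometric RR 1 2^-1.
rewrite /geometric /=; under eq_fun do rewrite mul1r; apply; rewrite ger0_norm; lra.
Qed.

Lemma linear_bounded_is_continuous (V W : normedModType RR) (f : V -> W) (c : RR) :
  is_linear f -> (forall x, `|f x| <= c * `|x|) -> continuous f.
Proof.
move=> fl fb x; apply/cvgrPdist_lt => e e0.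
have fB a b : f a - f b = f (a - b).
  by have := fl (-1) b a; rewrite !scaleN1r addrC [- f b + _]addrC => ->.
apply/nbhs_normP; exists (e / (`|c| + 1)) => /=.
  by apply: divr_gt0 => //; have := normr_ge0 c; lra.
move=> y /= xy; rewrite fB; apply: le_lt_trans (fb _) _.
have c1 : 0 < `|c| + 1 by have := normr_ge0 c; lra.
have : `|x - y| * (`|c| + 1) < e by rewrite -ltr_pdivlMr.
have := normr_ge0 (x - y); have := ler_norm c; nra.
Qed.

Lemma linear_continuous_is_bounded (V W : normedModType RR) (f : V -> W) :
  is_linear f -> continuous f -> exists2 c : RR, 0 < c & forall x, `|f x| <= c * `|x|.
Proof.
move=> fl fc.
have f0 : f 0 = 0 by have := fl (-1) 0 0; rewrite !scaleN1r oppr0 addr0 addNr.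
have fZ a x : f (a *: x) = a *: f x by have := fl a x 0; rewrite !addr0 f0 addr0.
have /cvgrPdist_lt /(_ 1 ltr01) /nbhs_normP [d /= d0 hd] := fc 0.
have hd' x : `|x| < d -> `|f x| < 1.
  by move=> xd; have := hd x; rewrite /= sub0r normrN f0 sub0r normrN; exact.
exists (2 / d); first by apply: divr_gt0; lra.
move=> x; have [->|x0] := eqVneq x 0; first by rewrite f0 !normr0 mulr0.
have nx : 0 < `|x| by rewrite normr_gt0.
have k0 : 0 < d / (2 * `|x|) by apply: divr_gt0 => //; lra.
have := hd' ((d / (2 * `|x|)) *: x).
rewrite fZ !normrZ (ger0_norm (ltW k0)).
have -> : d / (2 * `|x|) * `|x| = d / 2 by field; rewrite gt_eqF.
have h : d / 2 < d by lra.
move=> /(_ h) /ltW h1.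
have -> : 2 / d * `|x| = 1 / (d / (2 * `|x|)) by field; rewrite !gt_eqF.
by rewrite ler_pdivlMr // mulrC.
Qed.

(** * Positive functionals *)

Section Functionals.
Variable E : BanachLattice.
Implicit Types (x y z u v : E) (f h : E -> RR).

Definition functional f := forall a x y, f (a *: x + y) = a * f x + f y.

Definition pos_functional h :=
  [/\ functional h, (forall x, bl_pos x -> 0 <= h x) & exists c, forall x, `|h x| <= c * `|x|].

Lemma functional0 f : functional f -> f 0 = 0.
Proof. by move=> fl; have := fl (-1) 0 0; rewrite scaleN1r oppr0 addr0; lra. Qed.

Lemma functionalD f x y : functional f -> f (x + y) = f x + f y.
Proof. by move=> fl; have := fl 1 x y; rewrite scale1r mul1r. Qed.

Lemma functionalZ f a x : functional f -> f (a *: x) = a * f x.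
Proof. by move=> fl; have := fl a x 0; rewrite functional0 // !addr0. Qed.

Lemma functionalN f x : functional f -> f (- x) = - f x.
Proof. by move=> fl; rewrite -scaleN1r functionalZ // mulN1r. Qed.

Lemma functionalB f x y : functional f -> f (x - y) = f x - f y.
Proof. by move=> fl; rewrite functionalD // functionalN. Qed.

Lemma functional_sum f (I : Type) (s : seq I) (Q : pred I) (F : I -> E) : functional f ->
  f (\sum_(i <- s | Q i) F i) = \sum_(i <- s | Q i) f (F i).
Proof.
move=> fl; apply: (big_morph f) => [x y|]; [exact: functionalD | exact: functional0].
Qed.

Lemma functional_mono h x y : functional h -> (forall x, bl_pos x -> 0 <= h x) ->
  x <=: y -> h x <= h y.
Proof. by move=> hl hp /bl_subr_ge0 /hp; rewrite functionalB // subr_ge0. Qed.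

(** The extension is $h_0(x^+) - h_0(x^-)$. Additivity makes the value the same for every splitting
    of $x$ into a difference of positive vectors, so linearity can be checked on convenient
    splittings; a negative scalar exchanges the two parts. *)
Lemma kantorovich (h0 : E -> RR) :
  (forall x y, bl_pos x -> bl_pos y -> h0 (x + y) = h0 x + h0 y) ->
  (forall a x, 0 <= a -> bl_pos x -> h0 (a *: x) = a * h0 x) ->
  exists2 h, functional h & forall x, bl_pos x -> h x = h0 x.
Proof.
move=> hD hZ; pose h x := h0 (bl_pp x) - h0 (bl_pp (- x)).
have hE x a b : bl_pos a -> bl_pos b -> x = a - b -> h x = h0 a - h0 b.
  move=> pa pb e; rewrite /h.
  have e' : bl_pp x + b = a + bl_pp (- x) by rewrite bl_ppN e; module.
  have := hD _ _ (bl_pp_pos x) pb; rewrite e' hD //; last exact: bl_pp_pos.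
  by move=> hh; clear -hh; lra.
have h00 : h0 0 = 0 by have := hZ 0 0 (lexx _) (bl_pos0 E); rewrite scale0r mul0r.
exists h => [a x y|x px]; last by rewrite (hE x x 0) ?h00 ?subr0 //; exact: bl_pos0.
have ppp := @bl_pp_pos E.
have [a0|/ltW a0] := leP 0 a.
  rewrite (hE _ (a *: bl_pp x + bl_pp y) (a *: bl_pp (- x) + bl_pp (- y))).
  - by rewrite !hD ?hZ //; try exact: bl_posZ; rewrite /h; ring.
  - by apply: bl_posD => //; exact: bl_posZ.
  - by apply: bl_posD => //; exact: bl_posZ.
  - by rewrite !bl_ppN; module.
have na : 0 <= - a by rewrite oppr_ge0.
rewrite (hE _ ((- a) *: bl_pp (- x) + bl_pp y) ((- a) *: bl_pp x + bl_pp (- y))).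
- by rewrite !hD ?hZ //; try exact: bl_posZ; rewrite /h; ring.
- by apply: bl_posD => //; exact: bl_posZ.
- by apply: bl_posD => //; exact: bl_posZ.
- by rewrite !bl_ppN; module.
Qed.

(* For [J] everything this is the positive part of [f]; for an ideal [J] it is the part of
   it carried by [J]. *)
Lemma sup_functional f (c : RR) (J : E -> Prop) :
  functional f -> (forall x, `|f x| <= c * `|x|) ->
  J 0 -> (forall u v, J u -> J v -> J (u + v)) ->
  (forall a u, 0 <= a -> J u -> J (a *: u)) ->
  (forall u v, bl_pos v -> v <=: u -> J u -> J v) ->
  exists h, [/\ pos_functional h,
    (forall x u, bl_pos u -> u <=: x -> J u -> f u <= h x) &
    (forall x, bl_pos x -> (forall u, bl_pos u -> u <=: x -> J u -> f u <= 0) -> h x <= 0)].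
Proof.
move=> fl fb J0 JD JZ Jle.
have c0 x : 0 <= c * `|x| by apply: le_trans (fb x).
pose S x := [set r | exists u, [/\ bl_pos u, u <=: x, J u & r = f u]].
pose h0 x := sup (S x).
have fub u x : `|u| <= `|x| -> f u <= c * `|x|.
  move=> ux; apply: le_trans (ler_norm _) _; apply: le_trans (fb u) _.
  (* The constant [c] could be negative on the zero space, so its sign is read off from a nonzero
     [u]. *)
  have := normr_ge0 u; rewrite le_eqVlt => /orP[/eqP<-|u0]; first by rewrite mulr0.
  by apply: ler_wpM2l => //; have := c0 u; rewrite pmulr_lge0.
have Sub x : ubound (S x) (c * `|x|).
  by move=> _ [u [pu ux Ju ->]]; apply: (fub); exact: bl_norm_le.
have Sne x : bl_pos x -> S x !=set0.
  by move=> px; exists 0, 0; split=> //; [exact: bl_pos0 | rewrite functional0].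
have fle x u : bl_pos u -> u <=: x -> J u -> f u <= h0 x.
  move=> pu ux Ju; apply: ub_le_sup; last by exists u.
  by exists (c * `|x|); exact: Sub.
have hle x M : bl_pos x -> (forall u, bl_pos u -> u <=: x -> J u -> f u <= M) -> h0 x <= M.
  move=> px hM; apply: ge_sup; first exact: Sne.
  by move=> _ [u [pu ux Ju ->]]; exact: hM.
have hD x y : bl_pos x -> bl_pos y -> h0 (x + y) = h0 x + h0 y.
  move=> px py; apply/eqP; rewrite eq_le; apply/andP; split.
    apply: (hle); first exact: bl_posD.
    (* Both Riesz pieces of [u] lie below [u], so they remain in [J]. *)
    move=> u pu uxy Ju; have [p1 l1 p2 l2 e] := riesz_decomposition pu px py uxy.
    rewrite e functionalD //; apply: lerD; apply: (fle) => //.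
      by apply: Jle Ju => //; exact: bl_infl.
    by apply: Jle Ju => //; apply: bl_pp_least => //; apply: (bl_le_of_sub px); module.
  rewrite -lerBrDl; apply: (hle) => // v pv vy Jv.
  rewrite lerBrDl -lerBrDr; apply: (hle) => // u pu ux Ju.
  rewrite lerBrDr -functionalD //; apply: (fle); [exact: bl_posD|exact: bl_leD|exact: JD].
have hZ1 a x : 0 < a -> bl_pos x -> a * h0 x <= h0 (a *: x).
  move=> a0 px; rewrite mulrC -ler_pdivlMr //; apply: (hle) => // u pu ux Ju.
  rewrite ler_pdivlMr // mulrC -functionalZ //; apply: (fle).
  - by apply: bl_posZ => //; exact: ltW.
  - by apply: bl_le_scale => //; exact: ltW.
  - by apply: JZ => //; exact: ltW.
have hZ a x : 0 <= a -> bl_pos x -> h0 (a *: x) = a * h0 x.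
  rewrite le_eqVlt => /orP[/eqP<- px|a0 px].
    rewrite scale0r mul0r; apply/eqP; rewrite eq_le; apply/andP; split.
      apply: (hle); first exact: bl_pos0.
      move=> u pu u0 _; have -> : u = 0 by exact: bl_le_anti.
      by rewrite functional0.
    by rewrite -(functional0 fl); apply: (fle) => //; exact: bl_pos0.
  apply/eqP; rewrite eq_le hZ1 // andbT.
  have ai : 0 < a^-1 by rewrite invr_gt0.
  have := hZ1 _ _ ai (bl_posZ (ltW a0) px).
  by rewrite scalerA mulVf ?gt_eqF // scale1r ler_pdivrMl.
have [h hl hE] := kantorovich hD hZ.
have h0ge x : bl_pos x -> 0 <= h0 x.
  by move=> px; rewrite -(functional0 fl); apply: (fle) => //; exact: bl_pos0.
exists h; split.
- split=> // [x px|]; first by rewrite hE //; exact: h0ge.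
  exists c => x; rewrite -{1}(bl_pp_subN x) functionalB //.
  rewrite !hE; try exact: bl_pp_pos.
  have b z : `|z| = `|x| -> 0 <= h0 (bl_pp z) <= c * `|x|.
    move=> zx; rewrite h0ge; last exact: bl_pp_pos.
    apply: (hle) => [|u pu uz _]; first exact: bl_pp_pos.
    by apply: (fub); rewrite -zx; apply: le_trans (bl_norm_pp z); exact: bl_norm_le.
  have /andP[] := b x erefl; have /andP[] := b (- x) (normrN x).
  by rewrite ler_norml; clear; lra.
- move=> x u pu ux Ju; rewrite hE; last exact: bl_le_trans pu ux.
  exact: fle.
- by move=> x px hx; rewrite hE //; exact: hle.
Qed.

End Functionals.

(** * Weakly null sequences *)

Section WeakNull.
Variable E : BanachLattice.
Implicit Types (x y : nat -> E) (f h : E -> RR).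

Lemma weakly_null_pos_functional x h :
  weakly_null x -> pos_functional h -> null_seq (fun n => h (x n)).
Proof.
move=> wx [hl _ [c hb]]; apply/null_seqP; apply: (wx h) => //.
exact: (@linear_bounded_is_continuous _ RR^o h c).
Qed.

Lemma functional_dominated f (c : RR) : functional f -> (forall z : E, `|f z| <= c * `|z|) ->
  exists h, pos_functional h /\ forall u, bl_pos u -> f u <= h u.
Proof.
move=> fl fb; have [] // := @sup_functional E f c (fun=> True) fl fb.
by move=> h [hp hf _]; exists h; split=> // u pu; apply: hf => //; exact: bl_lexx.
Qed.

Lemma is_linear_functional (f : E -> RR^o) : is_linear f -> continuous f ->
  functional f /\ exists c : RR, forall z : E, `|f z| <= c * `|z|.
Proof.
move=> fl fc; split; first exact: fl.
by have [c _ h] := linear_continuous_is_bounded fl fc; exists c.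
Qed.

Lemma functional_opp f (c : RR) : functional f -> (forall z : E, `|f z| <= c * `|z|) ->
  functional (fun z => - f z) /\ forall z : E, `|- f z| <= c * `|z|.
Proof.
by move=> fl fb; split=> [a z y|z]; [rewrite fl; ring | rewrite normrN].
Qed.

(** On the positive cone a bounded functional is squeezed as $-h_2 \le f \le h_1$, where the
    positive functionals $h_1$ and $h_2$ dominate $f$ and $-f$. *)
Lemma weakly_null_of_pos_functional x : (forall n, bl_pos (x n)) ->
  (forall h, pos_functional h -> null_seq (fun n => h (x n))) -> weakly_null x.
Proof.
move=> px hx f fl0 fc; apply/null_seqP.
have [fl [c fb]] := is_linear_functional fl0 fc.
have [h1 [p1 d1]] := functional_dominated fl fb.
have [fl' fb'] := functional_opp fl fb.
have [h2 [p2 d2]] := functional_dominated fl' fb'.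
apply: null_seq_le (null_seqD (hx _ p1) (hx _ p2)) => n.
have [_ q1 _] := p1; have [_ q2 _] := p2.
have a1 := q1 _ (px n); have a2 := q2 _ (px n); have b1 := d1 _ (px n); have b2 := d2 _ (px n).
by rewrite ler_norml; clear -a1 a2 b1 b2; lra.
Qed.

Lemma weakly_null_le x y : (forall n, bl_pos (x n)) -> (forall n, x n <=: y n) ->
  weakly_null y -> weakly_null x.
Proof.
move=> px xy wy; apply: weakly_null_of_pos_functional => // h hp.
apply: null_seq_le (weakly_null_pos_functional wy hp) => n; have [hl hpos _] := hp.
by rewrite ger0_norm; [exact: functional_mono | exact: hpos].
Qed.

(* If [h] is the part of [f^+] carried by the ideal generated by the [x_i^+], then
   [h x_n = f^+ (x_n^+)], so weak nullity of [x] controls [f] on the [x_n^+]. *)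
Lemma pp_weakly_null x : pairwise_disjoint x -> weakly_null x ->
  weakly_null (fun n => bl_pp (x n)).
Proof.
move=> dx wx f fl0 fc; apply/null_seqP.
have [fl [c fb]] := is_linear_functional fl0 fc.
pose S k := \sum_(i < k) bl_pp (x i).
have pS k : bl_pos (S k) by apply: bl_pos_sum => i; exact: bl_pp_pos.
have S_le k l : (k <= l)%N -> S k <=: S l.
  elim: l => [|l IH]; first by rewrite leqn0 => /eqP->; exact: bl_lexx.
  rewrite leq_eqVlt => /orP[/eqP->|kl]; first exact: bl_lexx.
  apply: bl_le_trans (IH kl) _; rewrite /S big_ord_recr /=.
  by apply: bl_leDr; exact: bl_pp_pos.
(* On positive vectors this is membership in the ideal generated by the $x_i^+$. *)
pose J u := exists k (a : RR), 0 <= a /\ u <=: a *: S k.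
have J0 : J 0.
  by exists 0%N, 0; split=> //; rewrite scale0r; exact: bl_lexx.
have JD u v : J u -> J v -> J (u + v).
  move=> [k [a [a0 ua]]] [l [b [b0 vb]]]; exists (maxn k l), (a + b).
  split; first exact: addr_ge0.
  rewrite scalerDl; apply: bl_leD.
    by apply: bl_le_trans ua _; apply: bl_le_scale => //; apply: S_le; exact: leq_maxl.
  by apply: bl_le_trans vb _; apply: bl_le_scale => //; apply: S_le; exact: leq_maxr.
have JZ (a : RR) u : 0 <= a -> J u -> J (a *: u).
  move=> a0 [k [b [b0 ub]]]; exists k, (a * b); split; first exact: mulr_ge0.
  by rewrite -scalerA; exact: bl_le_scale.
have Jle u v : bl_pos v -> v <=: u -> J u -> J v.
  by move=> pv vu [k [b [b0 ub]]]; exists k, b; split=> //; exact: bl_le_trans vu ub.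
have Jx n : J (bl_pp (x n)).
  exists n.+1, 1; split=> //; rewrite scale1r /S big_ord_recr /=.
  by apply: bl_leDl; exact: pS.
(* The vector $x_n^-$ is disjoint from every $x_i^+$: for $i = n$ as the opposite part of the same
   vector, otherwise by pairwise disjointness. *)
have Jdisj n u : bl_pos u -> u <=: bl_pp (- x n) -> J u -> u = 0.
  move=> pu un [k [a [a0 ua]]]; apply: bl_le_anti pu.
  (* The factor [a] may be less than 1, while [bl_inf_scale_le] moves only factors at least 1 out of
     a meet. *)
  pose d := a + 1; have pn := bl_pp_pos (- x n).
  apply: (@bl_le_trans _ _ (bl_inf (bl_pp (- x n)) (d *: S k))).
    apply: bl_inf_greatest => //; apply: bl_le_trans ua _; apply: bl_leZr => //.
    by rewrite /d lerDl.
  have d1 : 1 <= d by rewrite /d lerDr.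
  apply: bl_le_trans (bl_inf_scale_le _ d1 pn) _.
  suff h : bl_inf (bl_pp (- x n)) (S k) <=: 0.
    have d0 : 0 <= d by exact: le_trans ler01 d1.
    by have := bl_le_scale d0 h; rewrite scaler0.
  apply: bl_le_trans (bl_inf_sum _ _ pn _) _; first by move=> i; exact: bl_pp_pos.
  rewrite big1; first exact: bl_lexx.
  move=> i _; have [ni|/eqP ni] := eqVneq n i.
    by rewrite -ni bl_infC bl_inf_ppN.
  apply: bl_inf_disj_le (dx _ _ ni); try exact: bl_pp_pos.
    by rewrite -bl_absN; exact: bl_pp_abs.
  exact: bl_pp_abs.
have main g : functional g -> (forall z : E, `|g z| <= c * `|z|) ->
    exists h, [/\ pos_functional h, forall n, g (bl_pp (x n)) <= h (x n) & forall n, 0 <= h (x n)].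
  move=> gl gb; have [h [hp hg h0]] := sup_functional gl gb J0 JD JZ Jle.
  have [hl hpos _] := hp.
  have hx n : h (bl_pp (x n)) = h (x n).
    rewrite -[x n in RHS]bl_pp_subN functionalB //.
    suff -> : h (bl_pp (- x n)) = 0 by rewrite subr0.
    apply/eqP; rewrite eq_le hpos ?andbT; last exact: bl_pp_pos.
    apply: h0; first exact: bl_pp_pos.
    by move=> u pu un Ju; rewrite (Jdisj n u) // functional0.
  exists h; split=> // n; rewrite -hx; last by apply: hpos; exact: bl_pp_pos.
  by apply: hg; [exact: bl_pp_pos | exact: bl_lexx | exact: Jx].
have [h1 [p1 d1 q1]] := main f fl fb.
have [fl' fb'] := functional_opp fl fb.
have [h2 [p2 d2 q2]] := main _ fl' fb'.
apply: null_seq_le (null_seqD (weakly_null_pos_functional wx p1)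
                              (weakly_null_pos_functional wx p2)) => n.
have a1 := q1 n; have a2 := q2 n; have b1 := d1 n; have b2 := d2 n.
by rewrite ler_norml; clear -a1 a2 b1 b2; lra.
Qed.

Lemma abs_weakly_null x : pairwise_disjoint x -> weakly_null x ->
  weakly_null (fun n => bl_abs (x n)).
Proof.
move=> dx wx; apply: weakly_null_of_pos_functional => [n|h hp]; first exact: bl_abs_pos.
have dN : pairwise_disjoint (fun n => - x n).
  by move=> n k nk; rewrite !bl_absN; exact: dx.
have wN : weakly_null (fun n => - x n).
  move=> f fl fc; apply/null_seqP.
  have [fl' _] := is_linear_functional fl fc.
  apply: null_seq_le (null_seq_norm ((null_seqP _).1 (wx f fl fc))) => n.
  by rewrite functionalN // normrN.
have h1 := weakly_null_pos_functional (pp_weakly_null dx wx) hp.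
have h2 := weakly_null_pos_functional (pp_weakly_null dN wN) hp.
apply: null_seq_le (null_seq_norm (null_seqD h1 h2)) => n.
by have [hl _ _] := hp; rewrite bl_absE functionalD.
Qed.

End WeakNull.

(** * Real series and finite suprema *)

Lemma null_seq_bounded_sums (a : nat -> RR) (B : RR) : (forall n, 0 <= a n) ->
  (forall n, \sum_(i < n) a i <= B) -> null_seq a.
Proof.
move=> a0 aB; apply: contrapT => /(not_null_seq a0) [e e0 he].
have key k : exists n, k%:R * e <= \sum_(i < n) a i.
  elim: k => [|k [n hn]]; first by exists 0%N; rewrite big_ord0 mul0r.
  have [m nm am] := he n; exists m.+1.
  rewrite big_ord_recr /= -[k.+1]addn1 natrD mulrDl mul1r; apply: lerD => //.
  apply: le_trans hn _; rewrite -!(big_mkord xpredT).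
  rewrite [leRHS](@big_cat_nat _ _ _ n) //=; last exact: ltnW.
  by rewrite lerDl; apply: sumr_ge0.
have Bge : 0 <= B / e.
  by apply: divr_ge0; [have := aB 0%N; rewrite big_ord0 | exact: ltW].
have [n hn] := key (Num.bound (B / e)).
have := archi_boundP Bge; rewrite ltr_pdivrMr // => h.
by have := lt_le_trans h (le_trans hn (aB n)); rewrite ltxx.
Qed.

Lemma null_seq_shift (k : nat) (a : nat -> RR) :
  null_seq (fun n => a (n + k)%N) -> null_seq a.
Proof.
move=> h e /h[N hN]; exists (N + k)%N => n Nn.
have kn : (k <= n)%N by exact: leq_trans (leq_addl _ _) Nn.
by rewrite -(subnK kn); apply: hN; lia.
Qed.

Lemma half_pow_le (m n : nat) : (m <= n)%N -> (2^-1 : RR) ^+ n <= 2^-1 ^+ m.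
Proof. by move=> mn; apply: ler_wiXn2l => //; lra. Qed.

Lemma half_pow_sum (k m : nat) : \sum_(k <= i < m) (2^-1 : RR) ^+ i <= 2 * 2^-1 ^+ k.
Proof.
have [km|mk] := leqP k m; last first.
  by rewrite big_geq ?mulr_ge0 ?half_pow_ge0 // ltnW.
suff -> : \sum_(k <= i < m) (2^-1 : RR) ^+ i = 2 * 2^-1 ^+ k - 2 * 2^-1 ^+ m.
  by have := half_pow_gt0 m; lra.
rewrite -(subnKC km); elim: (m - k)%N => [|n IH].
  by rewrite addn0 big_geq // subrr.
by rewrite addnS big_nat_recr ?leq_addr //= IH exprS; field.
Qed.

(** Starting from 0 gives empty ranges a value and makes the supremum positive for every family; for
    positive families nothing changes on nonempty ranges. *)
Fixpoint bl_supn (E : BanachLattice) (w : nat -> E) (k m : nat) : E :=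
  if m is m'.+1 then
    if (k <= m')%N then bl_sup (bl_supn w k m') (w m') else bl_supn w k m'
  else 0.

Section FiniteSup.
Variables (E : BanachLattice) (w : nat -> E).

Lemma bl_supn_pos k m : bl_pos (bl_supn w k m).
Proof.
elim: m => [|m IH] /=; first exact: bl_pos0.
by case: ifP => // _; apply: bl_le_trans IH _; exact: bl_sup_ubl.
Qed.

Lemma bl_supn_ub k m i : (k <= i < m)%N -> w i <=: bl_supn w k m.
Proof.
elim: m => [|m IH] /=; first by rewrite ltn0 andbF.
move=> /andP[ki]; rewrite ltnS leq_eqVlt => /orP[/eqP<-|im].
  by rewrite ki; exact: bl_sup_ubr.
have h : w i <=: bl_supn w k m by apply: IH; rewrite ki.
by case: ifP => // _; apply: bl_le_trans h _; exact: bl_sup_ubl.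
Qed.

Lemma bl_supn_least k m z : bl_pos z -> (forall i, (k <= i < m)%N -> w i <=: z) ->
  bl_supn w k m <=: z.
Proof.
move=> pz; elim: m => [|m IH] h //=.
have h' : bl_supn w k m <=: z.
  by apply: IH => i /andP[ki im]; apply: h; rewrite ki ltnS ltnW.
by case: ifP => // km; apply: bl_sup_least => //; apply: h; rewrite km ltnSn.
Qed.

Lemma bl_supn_le k l m n : (l <= k)%N -> (m <= n)%N -> bl_supn w k m <=: bl_supn w l n.
Proof.
move=> lk mn; apply: bl_supn_least => [|i /andP[ki im]]; first exact: bl_supn_pos.
by apply: bl_supn_ub; rewrite (leq_trans lk ki) (leq_trans im mn).
Qed.

Lemma bl_supn_sum k m : (forall i, bl_pos (w i)) -> bl_supn w k m <=: \sum_(k <= i < m) w i.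
Proof.
move=> pw; apply: bl_supn_least => [|i /andP[ki im]]; first exact: bl_pos_sum.
rewrite (bigD1_seq i) /= ?mem_index_iota ?ki ?iota_uniq //.
by apply: bl_leDr; exact: bl_pos_sum.
Qed.

End FiniteSup.

(** * Lattice seminorms controlled on disjoint sequences *)

Section Seminorm.
Variables (E : BanachLattice) (q : E -> RR) (C : RR).
Implicit Types (x y z u v : E).
Hypothesis q_mono : forall x y, bl_pos x -> x <=: y -> q x <= q y.
Hypothesis qD : forall x y, bl_pos x -> bl_pos y -> q (x + y) <= q x + q y.
Hypothesis qZ : forall (c : RR) x, 0 <= c -> bl_pos x -> q (c *: x) = c * q x.
Hypothesis qC : forall x, bl_pos x -> q x <= C * `|x|.
Hypothesis q_disj : forall y : nat -> E, (forall n, bl_pos (y n)) ->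
  (forall n k, n <> k -> bl_inf (y n) (y k) = 0) -> weakly_null y ->
  null_seq (fun n => q (y n)).

Let q0 : q 0 = 0.
Proof. by have := qZ (lexx 0) (bl_pos0 E); rewrite scale0r mul0r. Qed.

Let q_ge0 x : bl_pos x -> 0 <= q x.
Proof. by move=> px; rewrite -q0; apply: q_mono => //; exact: bl_pos0. Qed.

Let q_sum (I : Type) (s : seq I) (F : I -> E) : (forall i, bl_pos (F i)) ->
  q (\sum_(i <- s) F i) <= \sum_(i <- s) q (F i).
Proof.
move=> pF; elim: s => [|i s IH]; first by rewrite !big_nil q0.
rewrite !big_cons; apply: le_trans (qD (pF i) _) _; first exact: bl_pos_sum.
by rewrite lerD2l.
Qed.

(** Hahn-Banach is applied to the sublinear map $y \mapsto q(y^+)$. It vanishes on negative vectors,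
    which forces the functional to be positive. *)
Lemma norming_functional x : bl_pos x ->
  exists h, [/\ pos_functional h, forall y, bl_pos y -> h y <= q y & h x = q x].
Proof.
move=> px; pose p y := q (bl_pp y).
have pD y z : p (y + z) <= p y + p z.
  apply: le_trans (qD (bl_pp_pos y) (bl_pp_pos z)); apply: q_mono; first exact: bl_pp_pos.
  apply: bl_pp_least; first by apply: bl_leD; exact: bl_pp_ge.
  by apply: bl_posD; exact: bl_pp_pos.
have pZ (c : RR) y : 0 <= c -> p (c *: y) = c * p y.
  by move=> c0; rewrite /p bl_ppZ // qZ //; exact: bl_pp_pos.
have [h [hl hp hx]] := hahn_banach x pD pZ.
have hpos y : bl_pos y -> 0 <= h y.
  move=> py; have := hp (- y); rewrite functionalN // /p bl_pp_eq0 ?q0 ?oppr_le0 //.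
  by apply: (bl_le_of_sub py); module.
have hq y : bl_pos y -> h y <= q y by move=> py; have := hp y; rewrite /p bl_pp_id.
exists h; split=> //; last by rewrite hx /p bl_pp_id.
split=> //; exists C => y.
have hle z : h z <= C * `|z|.
  apply: le_trans (functional_mono hl hpos (bl_abs_ge z)) _.
  apply: le_trans (hq _ (bl_abs_pos z)) _.
  by apply: le_trans (qC (bl_abs_pos z)) _; rewrite bl_norm_abs.
have := hle (- y); rewrite functionalN // normrN ler_norml hle andbT => h1.
by rewrite lerNl.
Qed.

(* Disjointification: if the conclusion failed one could choose a subsequence [b] of [a]
   along which the truncations [(b_{k+1} - 4^k (b_1 + .. + b_k) - 2^-k x)^+], with [x]
   dominating all the [2^-k b_k], are disjoint without being [q]-null. *)
Lemma seminorm_tail (a : nat -> E) (M : RR) :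
  (forall n, bl_pos (a n)) -> (forall n, `|a n| <= M) ->
  (forall (y : nat -> E) (s : nat -> nat), (forall n, (n <= s n)%N) ->
     (forall n, bl_pos (y n)) -> (forall n, y n <=: a (s n)) ->
     (forall n k, n <> k -> bl_inf (y n) (y k) = 0) -> null_seq (fun n => q (y n))) ->
  forall d : RR, 0 < d -> exists N, forall n,
    q (bl_pp (a n - 4 ^+ N *: \sum_(i < N.+1) a i)) <= d.
Proof.
move=> pa aM ha d d0; apply: contrapT => hN.
pose S N := \sum_(i < N.+1) a i.
have aS i N : (i <= N)%N -> a i <=: S N.
  move=> iN; have iN1 : (i < N.+1)%N by [].
  rewrite /S (bigD1 (Ordinal iN1)) //=; apply: bl_leDr.
  exact: bl_pos_sum.
have pS N : bl_pos (S N) by exact: bl_pos_sum.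
have four_ge1 N : 1 <= (4 : RR) ^+ N by apply: exprn_ege1; lra.
have ex N : exists2 n, (N < n)%N & d < q (bl_pp (a n - 4 ^+ N *: S N)).
  apply: contrapT => h; apply: hN; exists N => n; rewrite leNgt; apply/negP => dq.
  (* For $n \le N$ the vector $a_n$ is a summand of [S N], so its truncation is zero; a violating
     index is therefore larger than [N]. *)
  apply: h; exists n => //; rewrite ltnNge; apply/negP => nN.
  move: dq; rewrite bl_pp_eq0 ?q0 ?(lt_gtF d0) //.
  suff h : a n <=: 4 ^+ N *: S N by apply: (bl_le_of_sub h); rewrite /S; module.
  apply: bl_le_trans (aS _ _ nN) _; rewrite -{1}[S N]scale1r.
  exact: bl_leZr.
have [s [s0 s_lt s_ge hs]] := extract ex 0%N.
have s_le i j : (i <= j)%N -> (s i <= s j)%N.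
  by rewrite leq_eqVlt => /orP[/eqP->|/s_lt/ltnW].
pose b k := a (s k).
have [x hx] : exists x, forall n, 2^-1 ^+ n *: b n <=: x.
  apply: (@bl_dominating _ _ M) => n; first by apply: bl_posZ; [exact: half_pow_ge0 | exact: pa].
  rewrite normrZ ger0_norm ?half_pow_ge0 // mulrC.
  by apply: ler_wpM2r; [exact: half_pow_ge0 | exact: aM].
have px : bl_pos x by apply: bl_le_trans (hx 0%N); rewrite expr0 scale1r; exact: pa.
have pxk k : bl_pos (2^-1 ^+ k *: x) by apply: bl_posZ px; exact: half_pow_ge0.
pose y k := bl_pp (b k.+1 - 4 ^+ s k *: S (s k) - 2^-1 ^+ k *: x).
have p4S k : bl_pos (4 ^+ s k *: S (s k)) by apply: bl_posZ => //; exact: le_trans (four_ge1 _).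
have disj i k : (i < k)%N -> bl_inf (y k) (y i) = 0.
  move=> ik.
  have c1 := four_ge1 k.
  (* In [y k] at least $4^k b_{i+1}$ is subtracted from $b_{k+1}$; in [y i] at least $2^{-i}
     2^{-(k+1)} b_{k+1}$ is subtracted from $b_{i+1}$, by way of [x]. The two factors multiply to
     $2^{k-i-1} \ge 1$, as [bl_inf_pp_sub] requires. *)
  have cd : 1 <= 4 ^+ k * (2^-1 ^+ i * 2^-1 ^+ k.+1) :> RR.
    have -> : (4 : RR) ^+ k * (2^-1 ^+ i * 2^-1 ^+ k.+1) = 2 ^+ (k - i.+1).
      rewrite -exprD -{1}(subnKC ik) -[in k.+1](subnKC ik).
      have -> : (4 : RR) = 2 ^+ 2 by rewrite expr2; ring.
      rewrite -exprM exprVn; apply: (mulIf (x := 2 ^+ (i + (i.+1 + (k - i.+1)).+1))).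
        by rewrite expf_neq0 // gt_eqF.
      rewrite -mulrA mulVf ?mulr1 ?expf_neq0 ?gt_eqF // -exprD; congr (_ ^+ _); lia.
    by apply: exprn_ege1; lra.
  apply: bl_inf_disj_le (bl_inf_pp_sub (pa (s k.+1)) (pa (s i.+1)) c1 cd);
    try exact: bl_pp_pos; apply: bl_pp_le.
    have h : 4 ^+ k *: a (s i.+1) <=: 4 ^+ s k *: S (s k).
      apply: (@bl_le_trans _ _ (4 ^+ s k *: a (s i.+1))).
        by apply: bl_leZr => //; apply: ler_weXn2l => //; lra.
      by apply: bl_le_scale; [exact: le_trans (four_ge1 _) | apply: aS; exact: s_le].
    by apply: (bl_le_of_sub (bl_leD h (pxk k))); rewrite /b; module.
  have h : 2^-1 ^+ i *: (2^-1 ^+ k.+1 *: a (s k.+1)) <=: 2^-1 ^+ i *: x.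
    by apply: bl_le_scale; [exact: half_pow_ge0 | exact: hx].
  by apply: (bl_le_of_sub (bl_leD h (p4S i))); rewrite /b; module.
have ynull : null_seq (fun n => q (y n)).
  apply: (ha y (fun k => s k.+1)).
  - by move=> n; exact: leq_trans (leqnSn n) (s_ge _).
  - by move=> n; exact: bl_pp_pos.
  - move=> n; apply: bl_pp_least; last exact: pa.
    by apply: (bl_le_of_sub (bl_leD (p4S n) (pxk n))); rewrite /b; module.
  - move=> n k; have [/disj ->//|/disj + _|->//] := ltngtP k n.
    by rewrite bl_infC.
have [N hN'] := null_seqD ynull (null_seqZ (q x) half_pow_null) d0.
have h1 := le_lt_trans (ler_norm _) (hN' N (leqnn N)).
suff h2 : q (bl_pp (a (s N.+1) - 4 ^+ s N *: S (s N))) <= q (y N) + q x * 2^-1 ^+ N.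
  by have := lt_trans (lt_le_trans (hs N) h2) h1; rewrite ltxx.
rewrite [q x * _]mulrC -qZ ?half_pow_ge0 //.
apply: le_trans (qD _ _); [|exact: bl_pp_pos|exact: pxk].
apply: q_mono; first exact: bl_pp_pos.
apply: bl_pp_least; last by apply: bl_posD; [exact: bl_pp_pos|exact: pxk].
by apply: (bl_le_of_sub (bl_pp_ge (b N.+1 - 4 ^+ s N *: S (s N) - 2^-1 ^+ N *: x)));
  rewrite /y /b; module.
Qed.

(** Partial sums of disjoint vectors are suprema and stay below [u]. A positive functional thus has
    partial sums bounded by its value at [u], and its terms tend to 0. *)
Lemma disjoint_bounded_weakly_null (y : nat -> E) u : (forall n, bl_pos (y n)) ->
  (forall n, y n <=: u) -> (forall n k, n <> k -> bl_inf (y n) (y k) = 0) -> weakly_null y.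
Proof.
move=> py yu dy; apply: weakly_null_of_pos_functional => // h [hl hpos _].
have sum_le n : \sum_(i < n) y i <=: u.
  elim: n => [|n IH]; first by rewrite big_ord0; exact: bl_le_trans (py 0%N) (yu 0%N).
  rewrite big_ord_recr /=; apply: bl_disj_add_le => //.
  rewrite bl_infC; apply: bl_le_anti; last by apply: bl_inf_pos => //; exact: bl_pos_sum.
  apply: bl_le_trans (bl_inf_sum _ _ (py n) _) _ => //.
  rewrite big1; first exact: bl_lexx.
  by move=> i _; apply: dy => ni; have := ltn_ord i; rewrite -ni ltnn.
apply: (@null_seq_bounded_sums _ (h u)) => n; first exact: hpos.
by rewrite -functional_sum //; exact: functional_mono.
Qed.

(** Induction on the number [K] of terms that may overlap. By [seminorm_tail], up to a small error
    $e_n$ lies below a multiple of $e_0 + \dots + e_N$. For fixed $i$ the meets $e_n \wedge e_i$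
    with $n > i$ overlap one time fewer, so the induction hypothesis makes them null. *)
Lemma finite_multiplicity_null K : forall (e : nat -> E) u, (forall n, bl_pos (e n)) ->
  (forall n, e n <=: u) ->
  (forall (s : seq nat) z, uniq s -> size s = K.+1 -> bl_pos z ->
     (forall i, i \in s -> z <=: e i) -> z = 0) ->
  null_seq (fun n => q (e n)).
Proof.
elim: K => [|K IH] e u pe eu he.
  move=> r r0; exists 0%N => n _; rewrite (he [:: n] (e n)) ?q0 ?normr0 //.
  by move=> i; rewrite inE => /eqP->; exact: bl_lexx.
have tail : forall d : RR, 0 < d -> exists N, forall n,
    q (bl_pp (e n - 4 ^+ N *: \sum_(i < N.+1) e i)) <= d.
  apply: (@seminorm_tail e `|u|) => // [n|y s s_ge py ys dy]; first exact: bl_norm_le.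
  apply: q_disj => //; apply: (@disjoint_bounded_weakly_null y u) => // n.
  exact: bl_le_trans (ys n) (eu _).
have meet_null i : null_seq (fun n => q (bl_inf (e n) (e i))).
  (* The shift keeps [i] distinct from the other indices: a minorant of [K.+1] such meets is a
     minorant of [K.+2] different terms of [e]. *)
  apply: (@null_seq_shift i.+1); apply: (IH _ u) => [n|n|s z us ss pz hz].
  - exact: bl_inf_pos.
  - exact: bl_le_trans (bl_infl _ _) (eu _).
  apply: (he (i :: [seq (j + i.+1)%N | j <- s])) => //=.
  - rewrite map_inj_uniq ?us ?andbT; last by move=> a b /addIn.
    by apply/mapP => -[j _]; lia.
  - by rewrite size_map ss.
  - move=> j; rewrite inE => /orP[/eqP->|/mapP[k ks ->]].
      case: s ss hz {us} => [//|k s] _ hz.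
      by apply: bl_le_trans (hz k _) (bl_infr _ _); rewrite inE eqxx.
    exact: bl_le_trans (hz k ks) (bl_infl _ _).
move=> r r0; have [N hN] := tail (r / 2) (divr_gt0 r0 (ltr0n _ 2)).
pose S := \sum_(i < N.+1) e i.
have pS : bl_pos S by exact: bl_pos_sum.
have four_ge1 : 1 <= (4 : RR) ^+ N by apply: exprn_ege1; lra.
have four_ge0 : 0 <= (4 : RR) ^+ N by lra.
have p4S : bl_pos (4 ^+ N *: S) by exact: bl_posZ.
have bound n : q (e n) <= r / 2 + 4 ^+ N * \sum_(i < N.+1) q (bl_inf (e n) (e i)).
  rewrite -{1}(bl_pp_inf (e n) (4 ^+ N *: S)).
  apply: le_trans (qD _ _) _; [exact: bl_pp_pos|exact: bl_inf_pos|].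
  apply: lerD => //.
  apply: le_trans (q_mono _ (bl_inf_scale_le S four_ge1 (pe n))) _; first exact: bl_inf_pos.
  rewrite qZ //; last exact: bl_inf_pos.
  apply: ler_wpM2l => //.
  apply: le_trans (q_mono _ (bl_inf_sum _ _ (pe n) _)) _ => //; first exact: bl_inf_pos.
  by apply: q_sum => i; exact: bl_inf_pos.
have [M hM] := null_seqZ (4 ^+ N) (null_seq_sum N.+1 meet_null) (divr_gt0 r0 (ltr0n _ 2)).
exists M => n /hM h; rewrite ger0_norm; last exact: q_ge0.
by have := ler_norm (4 ^+ N * \sum_(i < N.+1) q (bl_inf (e n) (e i))); have := bound n;
   lra.
Qed.

(* [(d_n - t u)^+] vanishes on all but [1 / t] of the indices at each point, in
   the sense that meets of more than [1 / t] of them are zero. *)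
Lemma summable_null (d : nat -> E) u : (forall n, bl_pos (d n)) ->
  (forall n, \sum_(i < n) d i <=: u) -> null_seq (fun n => q (d n)).
Proof.
move=> pd du.
have pu : bl_pos u by have := du 0%N; rewrite big_ord0.
have du1 n : d n <=: u.
  by apply: bl_le_trans (du n.+1); rewrite big_ord_recr /=; apply: bl_leDl; exact: bl_pos_sum.
have dus (s : seq nat) : uniq s -> \sum_(i <- s) d i <=: u.
  move=> us; pose n := (\max_(i <- s) i).+1.
  have sn i : i \in s -> (i < n)%N by move=> si; rewrite ltnS; exact: leq_bigmax_seq.
  have ps : perm_eq s [seq i <- iota 0 n | i \in s].
    apply: uniq_perm => //; first exact: filter_uniq (iota_uniq 0 n).
    move=> i; rewrite mem_filter mem_iota /= add0n.
    by case si: (i \in s) => //=; rewrite (sn i si).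
  rewrite (perm_big _ ps) big_filter; apply: bl_le_trans (du n).
  rewrite -(big_mkord xpredT d) /index_iota subn0 [X in _ <=: X](bigID (mem s)) /=.
  by apply: bl_leDr; exact: bl_pos_sum.
move=> r r0; have qu := q_ge0 pu.
(* This makes $q(tu) \le r/2$; the summand 1 guards against [q u = 0]. *)
pose t := r / (2 * (q u + 1)).
have qu1 : 0 < 2 * (q u + 1) by  lra.
have t0 : 0 < t by exact: divr_gt0.
have tq : t * q u <= r / 2.
  have -> : r / 2 = t * (q u + 1) by rewrite /t; field; rewrite gt_eqF //;  lra.
  by apply: ler_wpM2l;  lra.
pose e n := bl_pp (d n - t *: u).
have ptu : bl_pos (t *: u) by apply: bl_posZ => //; exact: ltW.
pose K := Num.bound (t^-1).
have Kt : 1 <= K.+1%:R * t.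
  have : t^-1 < K%:R by apply: archi_boundP; rewrite invr_ge0 ltW.
  rewrite -(ltr_pM2r t0) mulVf ?gt_eqF // => h.
  by rewrite -natr1 mulrDl mul1r;  lra.
have enull : null_seq (fun n => q (e n)).
  apply: (@finite_multiplicity_null K e u) => [n|n|s z us ss pz hz].
  - exact: bl_pp_pos.
  - apply: bl_pp_least => //; apply: bl_le_trans (du1 n).
    by apply: (bl_le_of_sub ptu); module.
  (* Here [v] is the meet of the $d_i - tu$ over [s]. Summing its bounds gives $(K+1) v \le \sum d_i
     - (K+1) t u \le u - u = 0$, hence $v^+ = 0$. *)
  have [v zv hv] : exists2 v, z <=: bl_pp v & forall i, i \in s -> v <=: d i - t *: u.
    case: s us ss hz => [//|k s] _ _; elim: s k => [|l s IH] k hz.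
      exists (d k - t *: u); first by apply: hz; rewrite inE eqxx.
      by move=> i; rewrite inE => /eqP->; exact: bl_lexx.
    have [v zv hv] := IH l (fun i si => hz i (mem_behead (s := k :: l :: s) si)).
    exists (bl_inf (d k - t *: u) v).
      by apply: bl_le_pp_inf => //; apply: hz; rewrite inE eqxx.
    move=> i; rewrite inE => /orP[/eqP->|si]; first exact: bl_infl.
    exact: bl_le_trans (bl_infr _ _) (hv i si).
  apply: bl_le_anti pz; apply: bl_le_trans zv _; apply: bl_pp_least (bl_lexx _).
  have sumv : K.+1%:R *: v <=: \sum_(i <- s) (d i - t *: u).
    rewrite -ss; elim: s {us ss hz} hv => [|k s IH] hv.
      by rewrite big_nil scale0r; exact: bl_lexx.
    rewrite big_cons /= -natr1 scalerDl scale1r addrC; apply: bl_leD.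
      by apply: hv; rewrite inE eqxx.
    by apply: IH => i si; apply: hv; rewrite inE si orbT.
  have h : K.+1%:R *: v <=: 0.
    apply: bl_le_trans sumv _; rewrite sumrB big_const_seq count_predT ss iter_addr_0.
    have h1 : u <=: (K.+1%:R * t) *: u by rewrite -{1}[u]scale1r; exact: bl_leZr.
    apply: (bl_le_of_sub (bl_leD (dus s us) h1)).
    by rewrite -scaler_nat -[X in 0 - (X - _)]/(\sum_(i <- s) d i); module.
  have K0 : 0 <= (K.+1%:R : RR)^-1 by rewrite invr_ge0.
  have Kn0 : (K.+1%:R : RR) != 0 by rewrite pnatr_eq0.
  by have := bl_le_scale K0 h; rewrite scalerA (mulVf Kn0) scale1r scaler0.
have [M hM] := enull (r / 2) (divr_gt0 r0 (ltr0n _ 2)).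
exists M => n /hM h; rewrite ger0_norm; last exact: q_ge0.
have h1 : q (d n) <= q (e n) + t * q u.
  rewrite -qZ //; last exact: ltW.
  apply: le_trans (qD _ _) => //; last exact: bl_pp_pos.
  apply: q_mono => //.
  by apply: (bl_le_of_sub (bl_pp_ge (d n - t *: u))); rewrite /e; module.
by have := ler_norm (q (e n));  lra.
Qed.

(** Otherwise some subsequence has increments with [q] above [r]; but these increments are positive
    with partial sums below [u], so [summable_null] applies. *)
Lemma monotone_cauchy (v : nat -> E) u :
  (forall i j, (i <= j)%N -> v i <=: v j) -> (forall n, bl_pos (v n)) -> (forall n, v n <=: u) ->
  forall r : RR, 0 < r -> exists N, forall n, (N <= n)%N -> q (v n - v N) <= r.
Proof.
move=> v_le pv vu r r0; apply: contrapT => hN.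
have ex N : exists2 n, (N < n)%N & r < q (v n - v N).
  apply: contrapT => h; apply: hN; exists N => n Nn; rewrite leNgt; apply/negP => rq.
  apply: h; exists n => //; move: Nn rq; rewrite leq_eqVlt => /orP[/eqP->|//].
  by rewrite subrr q0 ltNge ltW.
have [s [_ s_lt _ hs]] := extract ex 0%N.
have pd k : bl_pos (v (s k.+1) - v (s k)).
  by apply/bl_subr_ge0; apply: v_le; apply: ltnW; exact: s_lt.
have dnull : null_seq (fun k => q (v (s k.+1) - v (s k))).
  apply: (@summable_null _ u) => // n.
  rewrite -(big_mkord xpredT (fun i => v (s i.+1) - v (s i))) telescope_sumr //.
  apply: bl_le_trans (vu (s n)).
  by apply: (bl_le_of_sub (pv (s 0%N))); module.
have [M hM] := dnull r r0.
have := lt_trans (hs M) (le_lt_trans (ler_norm _) (hM M (leqnn M))).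
by rewrite ltxx.
Qed.

Lemma bounded_weakly_null_null (w : nat -> E) u : (forall n, bl_pos (w n)) ->
  (forall n, w n <=: u) -> weakly_null w -> null_seq (fun n => q (w n)).
Proof.
move=> pw wu ww; apply: contrapT => nq.
have [e e0 he] := not_null_seq (fun n => q_ge0 (pw n)) nq.
have [phi hphi] := choice (fun n => norming_functional (pw n)).
have phi_pos j n : 0 <= phi j (w n) by have [[_ h _] _ _] := hphi j; exact: h.
(* The finitely many functionals [phi j] with $j \le N$ tend to 0 along [w], so they are jointly
   small at some later term that [q] still keeps above [e]. *)
have ex N : exists2 n, (N < n)%N &
    e <= q (w n) /\ forall j, (j <= N)%N -> phi j (w n) <= 2^-1 ^+ N.
  have sn : null_seq (fun n => \sum_(j < N.+1) phi j (w n)).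
    apply: (@null_seq_sum N.+1 (fun j n => phi j (w n))) => j; have [hj _ _] := hphi j.
    exact: weakly_null_pos_functional ww hj.
  have [M hM] := sn _ (half_pow_gt0 N).
  have [n Mn en] := he (maxn N M); exists n; first exact: leq_ltn_trans (leq_maxl _ _) Mn.
  split=> // j jN; have jN1 : (j < N.+1)%N by [].
  have Mn' : (M <= n)%N by apply: leq_trans (leq_maxr _ _) (ltnW Mn).
  apply: le_trans (ltW (le_lt_trans (ler_norm _) (hM n Mn'))).
  rewrite (bigD1 (Ordinal jN1)) //= lerDl; exact: sumr_ge0.
have [s [_ s_lt s_ge hs]] := extract ex 0%N.
pose W k := w (s k.+1); pose F k := phi (s k.+1).
have Fl k : functional (F k) by have [[h _ _] _ _] := hphi (s k.+1).
have Fpos k x : bl_pos x -> 0 <= F k x by have [[_ h _] _ _] := hphi (s k.+1); exact: h.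
have Fq k x : bl_pos x -> F k x <= q x by have [_ h _] := hphi (s k.+1); exact: h.
have Fle k x y : x <=: y -> F k x <= F k y by apply: functional_mono => //; exact: Fpos.
have FW k : e <= F k (W k).
  by rewrite /F /W; have [_ _ ->] := hphi (s k.+1); have [] := hs k.
have FW' j i : (j < i)%N -> F j (W i) <= 2^-1 ^+ i.
  move=> ji; have [_ h] := hs i; apply: le_trans (h (s j.+1) _) _.
    by move: ji; rewrite leq_eqVlt => /orP[/eqP->//|/s_lt/ltnW].
  exact: half_pow_le.
have pW k : bl_pos (W k) by exact: pw.
have pu : bl_pos u by exact: bl_le_trans (pw 0%N) (wu 0%N).
pose v := bl_supn W.
have vu k m : v k m <=: u by apply: bl_supn_least => // i _; exact: wu.
pose eta := e / 8.
have eta0 : 0 < eta by rewrite /eta; lra.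
have exM k : exists M, forall m, (M <= m)%N -> q (v k m - v k M) <= eta * 2^-1 ^+ k.
  apply: (@monotone_cauchy (v k) u) => //.
  - by move=> i j ij; exact: bl_supn_le.
  - by move=> n; exact: bl_supn_pos.
  - by apply: mulr_gt0 => //; exact: half_pow_gt0.
have [M hM] := choice exM.
(* This cut-off is past [M k], increases with [k], and exceeds [k], so that [W k] itself enters
   [t k]. *)
pose m k := (k.+1 + \sum_(j < k.+1) M j)%N.
have m_le j k : (j <= k)%N -> (m j <= m k)%N.
  move=> jk; rewrite /m leq_add ?ltnS // -!(big_mkord xpredT M).
  by rewrite [leqRHS](@big_cat_nat _ _ _ j.+1) //= leq_addr.
have Mm j : (M j <= m j)%N by rewrite /m big_ord_recr /= addnA leq_addl.
pose t k := v k (m k).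
(* As the cut-off moves with [k], the $t_k$ need not decrease; their running meets $t_0 \wedge \dots
   \wedge t_k$ do. *)
pose V := fix V k := if k is k'.+1 then bl_inf (V k') (t k) else t 0%N.
have pt k : bl_pos (t k) by exact: bl_supn_pos.
have pV k : bl_pos (V k) by elim: k => [|k IH] /=; [exact: pt | exact: bl_inf_pos].
have Vt k : V k <=: t k by case: k => [|k] /=; [exact: bl_lexx | exact: bl_infr].
(* For $j \le k$ the vector $t_k$ exceeds $t_j$ by at most this error, so it exceeds $V_k$ by at
   most the sum of the errors, whose [q] values add up to no more than [2 * eta]. *)
pose r j k := v j (m k) - t j.
have pr j k : (j <= k)%N -> bl_pos (r j k).
  by move=> jk; apply/bl_subr_ge0; apply: bl_supn_le => //; exact: m_le.
have qr j k : (j <= k)%N -> q (r j k) <= eta * 2^-1 ^+ j.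
  move=> jk; apply: le_trans (hM j (m k) _); last exact: leq_trans (Mm j) (m_le _ _ jk).
  apply: q_mono; first exact: pr.
  have h : v j (M j) <=: t j by exact: bl_supn_le.
  by apply: (bl_le_of_sub h); rewrite /r; module.
have tr j k : (j <= k)%N -> t k <=: t j + r j k.
  move=> jk; have h : t k <=: v j (m k) by exact: bl_supn_le.
  by apply: (bl_le_of_sub h); rewrite /r; module.
have tV l k : (l <= k)%N -> t k <=: V l + \sum_(j < l.+1) r j k.
  elim: l => [_|l IH lk].
    by rewrite big_ord1; exact: tr.
  rewrite big_ord_recr /=; set R := \sum_(j < _) _.
  have h1 : t k <=: V l + R by apply: IH; exact: ltnW.
  have pR : bl_pos R.
    apply: big_ind => [||j _]; [exact: bl_pos0|exact: bl_posD|apply: pr].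
    by apply: leq_trans lk; exact: ltnW.
  have h : t k - (R + r l.+1 k) <=: bl_inf (V l) (t l.+1).
    apply: bl_inf_greatest.
      by apply: (bl_le_of_sub (bl_leD h1 (pr _ _ lk))); module.
    by apply: (bl_le_of_sub (bl_leD (tr _ _ lk) pR)); module.
  by apply: (bl_le_of_sub h); module.
have pd k : bl_pos (V k - V k.+1) by apply/bl_subr_ge0; exact: bl_infl.
have dnull : null_seq (fun k => q (V k - V k.+1)).
  apply: (@summable_null _ u) => // n.
  apply: (@bl_le_trans _ _ (V 0%N - V n)); last first.
    by apply: (bl_le_of_sub (bl_leD (vu 0%N (m 0%N)) (pV n))) => /=; rewrite /t; module.
  elim: n => [|n IH]; first by rewrite big_ord0 subrr; exact: bl_lexx.
  rewrite big_ord_recr /=; apply: (bl_le_of_sub IH); module.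
(* The contradiction is $e \le F_k(W_k) \le F_k(t_k) \le F_k(V_k) + e/4$, where $F_k(V_k) \le q(V_k
   - V_{k+1}) + F_k(t_{k+1})$ and the last term is at most $\sum_{i > k} 2^{-i} \le 2^{-k}$. For
   large $k$ the total is below $5e/8$. *)
have e4 : 0 < e / 4 by lra.
have e8 : 0 < e / 8 by lra.
have [N1 h1] := dnull _ e4; have [N2 h2] := half_pow_null e8.
pose k := maxn N1 N2.
have a1 := le_lt_trans (ler_norm _) (h1 k (leq_maxl _ _)).
have a2 := le_lt_trans (ler_norm _) (h2 k (leq_maxr _ _)).
have a3 : F k (W k) <= F k (t k).
  by apply: Fle; apply: bl_supn_ub; rewrite leqnn /m addSn ltnS leq_addr.
have a4 : F k (t k) <= F k (V k) + 2 * eta.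
  apply: le_trans (Fle _ _ _ (tV k k (leqnn k))) _.
  rewrite functionalD // functional_sum // lerD2l.
  apply: (@le_trans _ _ (\sum_(j < k.+1) eta * 2^-1 ^+ j)).
    apply: ler_sum => j _; have jk : (j <= k)%N by rewrite -ltnS.
    exact: le_trans (Fq _ _ (pr _ _ jk)) (qr _ _ jk).
  rewrite -mulr_sumr mulrC; apply: ler_wpM2r; first exact: ltW.
  by have := half_pow_sum 0 k.+1; rewrite big_mkord expr0 mulr1.
have a5 : F k (V k) <= q (V k - V k.+1) + F k (V k.+1).
  have -> : F k (V k) = F k (V k - V k.+1) + F k (V k.+1) by rewrite functionalB // subrK.
  by rewrite lerD2r; exact: Fq.
have a6 : F k (V k.+1) <= 2^-1 ^+ k.
  apply: le_trans (Fle _ _ _ (Vt k.+1)) _.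
  apply: le_trans (Fle _ _ _ (bl_supn_sum k.+1 (m k.+1) pW)) _.
  rewrite functional_sum //.
  apply: (@le_trans _ _ (\sum_(k.+1 <= i < m k.+1) 2^-1 ^+ i)).
    by rewrite big_nat_cond [leRHS]big_nat_cond; apply: ler_sum => i; rewrite andbT => /andP[ki _];
      exact: FW'.
  by apply: le_trans (half_pow_sum _ _) _; rewrite exprS mulrA mulfV ?mul1r.
have a7 := FW k.
move: a1 a2 a3 a4 a5 a6 a7; rewrite /eta.
move: (F k (W k)) (F k (t k)) (F k (V k)) (F k (V k.+1)) (q (V k - V k.+1)) (2^-1 ^+ k).
by move=> b1 b2 b3 b4 b5 b6; lra.
Qed.

(** Split $x_n = (x_n - u)^+ + x_n \wedge u$. Disjoint sequences below a subsequence of $x$ are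
    weakly null, so [seminorm_tail] supplies a [u] making the first part small; the second part is
    order bounded and weakly null. *)
Theorem seminorm_null (x : nat -> E) (M : RR) : (forall n, bl_pos (x n)) ->
  (forall n, `|x n| <= M) -> weakly_null x -> null_seq (fun n => q (x n)).
Proof.
move=> px xM wx r r0; have r2 : 0 < r / 2 by lra.
have [N hN] : exists N, forall n, q (bl_pp (x n - 4 ^+ N *: \sum_(i < N.+1) x i)) <= r / 2.
  apply: (@seminorm_tail x M) => // y s s_ge py ys dy; apply: q_disj => //.
  apply: weakly_null_of_pos_functional => // h hp.
  apply: null_seq_le (null_seq_sub s_ge (weakly_null_pos_functional wx hp)) => n.
  by have [hl hpos _] := hp; rewrite ger0_norm ?hpos //; exact: functional_mono.
set u := 4 ^+ N *: _ in hN.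
have pu : bl_pos u by apply: bl_posZ; [exact: exprn_ge0 | exact: bl_pos_sum].
have wn : null_seq (fun n => q (bl_inf (x n) u)).
  apply: (@bounded_weakly_null_null _ u) => [n|n|]; [exact: bl_inf_pos|exact: bl_infr|].
  by apply: weakly_null_le wx => n; [exact: bl_inf_pos|exact: bl_infl].
have [K hK] := wn _ r2; exists K => n /hK h.
rewrite ger0_norm; last exact: q_ge0.
have h1 : q (x n) <= q (bl_pp (x n - u)) + q (bl_inf (x n) u).
  by rewrite -{1}(bl_pp_inf (x n) u); apply: qD; [exact: bl_pp_pos|exact: bl_inf_pos].
have := ler_norm (q (bl_inf (x n) u)); have := hN n; lra.
Qed.

End Seminorm.

(** * Almost Dunford-Pettis operators on positive weakly null sequences *)

Lemma norm_nullP (F : normedModType RR) (x : nat -> F) :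
  norm_null x <-> null_seq (fun n => `|x n|).
Proof. exact: null_seqP. Qed.

Lemma is_linear0 (U V : lmodType RR) (f : U -> V) : is_linear f -> f 0 = 0.
Proof. by move=> fl; have := fl (-1) 0 0; rewrite !scaleN1r oppr0 addr0 addNr. Qed.

Lemma is_linearD (U V : lmodType RR) (f : U -> V) x y : is_linear f -> f (x + y) = f x + f y.
Proof. by move=> fl; have := fl 1 x y; rewrite !scale1r. Qed.

Lemma is_linearZ (U V : lmodType RR) (f : U -> V) a x : is_linear f -> f (a *: x) = a *: f x.
Proof. by move=> fl; have := fl a x 0; rewrite !addr0 (is_linear0 fl) addr0. Qed.

Lemma is_linearB (U V : lmodType RR) (f : U -> V) x y : is_linear f -> f (x - y) = f x - f y.
Proof. by move=> fl; rewrite is_linearD // -scaleN1r is_linearZ // scaleN1r. Qed.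

(** The norm of [u x] need not be monotone in [x]. Its monotone envelope [q] dominates it on
    positive vectors and is subadditive by Riesz decomposition. *)
Lemma almost_DP_pos (H : BanachLattice) (F : normedModType RR) (u : H -> F) :
  is_linear u -> continuous u -> almost_DP u ->
  forall (x : nat -> H) (M : RR), (forall n, bl_pos (x n)) -> (forall n, `|x n| <= M) ->
    weakly_null x -> norm_null (fun n => u (x n)).
Proof.
move=> ul uc uDP x M px xM wx.
have [c c0 ub] := linear_continuous_is_bounded ul uc.
pose S (z : H) := [set r : RR | exists y, [/\ bl_pos y, y <=: z & r = `|u y|]].
pose q z := sup (S z).
have Sub z : ubound (S z) (c * `|z|).
  move=> _ [y [py yz ->]]; apply: le_trans (ub y) _.
  by apply: ler_wpM2l; [exact: ltW | exact: bl_norm_le].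
have Sne z : bl_pos z -> S z !=set0.
  by move=> pz; exists `|u 0|, 0; split=> //; exact: bl_pos0.
have q_ge z y : bl_pos y -> y <=: z -> `|u y| <= q z.
  move=> py yz; apply: ub_le_sup; last by exists y.
  by exists (c * `|z|); exact: Sub.
have q_le z (B : RR) : bl_pos z -> (forall y, bl_pos y -> y <=: z -> `|u y| <= B) -> q z <= B.
  move=> pz h; apply: ge_sup; first exact: Sne.
  by move=> _ [y [py yz ->]]; exact: h.
have q_mono z z' : bl_pos z -> z <=: z' -> q z <= q z'.
  move=> pz zz'; apply: (q_le) => // y py yz; apply: (q_ge) => //.
  exact: bl_le_trans yz zz'.
have qD z z' : bl_pos z -> bl_pos z' -> q (z + z') <= q z + q z'.
  move=> pz pz'; apply: (q_le) => [|y py yzz]; first exact: bl_posD.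
  have [p1 l1 p2 l2 ->] := riesz_decomposition py pz pz' yzz.
  rewrite is_linearD //; apply: le_trans (ler_normD _ _) _.
  by apply: lerD; exact: q_ge.
have qZ1 (a : RR) z : 0 < a -> bl_pos z -> a * q z <= q (a *: z).
  move=> a0 pz; rewrite mulrC -ler_pdivlMr //; apply: (q_le) => // y py yz.
  rewrite ler_pdivlMr // mulrC -{1}(ger0_norm (ltW a0)) -normrZ -is_linearZ //.
  by apply: (q_ge); [exact: bl_posZ (ltW a0) py | exact: bl_le_scale (ltW a0) yz].
have qZ (a : RR) z : 0 <= a -> bl_pos z -> q (a *: z) = a * q z.
  rewrite le_eqVlt => /orP[/eqP<- pz|a0 pz].
    rewrite scale0r mul0r; apply/eqP; rewrite eq_le; apply/andP; split.
      apply: (q_le) => [|y py y0]; first exact: bl_pos0.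
      by rewrite (bl_le_anti y0 py) is_linear0 // normr0.
    by apply: le_trans (normr_ge0 (u 0)) _; apply: (q_ge); exact: bl_lexx.
  apply/eqP; rewrite eq_le qZ1 // andbT.
  have ai : 0 < a^-1 by rewrite invr_gt0.
  have := qZ1 _ _ ai (bl_posZ (ltW a0) pz).
  by rewrite scalerA mulVf ?gt_eqF // scale1r ler_pdivrMl.
have qC z : bl_pos z -> q z <= c * `|z|.
  by move=> pz; apply: ge_sup; [exact: Sne | exact: Sub].
have q_disj (y : nat -> H) : (forall n, bl_pos (y n)) ->
    (forall n k, n <> k -> bl_inf (y n) (y k) = 0) -> weakly_null y ->
    null_seq (fun n => q (y n)).
  move=> py dy wy.
  (* Near-maximizers for [q (y n)] lie below the [y n], so they inherit disjointness and weak
     nullity, and the hypothesis on [u] applies to them. *)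
  have ex n : exists z, [/\ bl_pos z, z <=: y n & q (y n) <= `|u z| + 2^-1 ^+ n].
    have hs : has_sup (S (y n)).
      by split; [exact: Sne | exists (c * `|y n|); exact: Sub].
    have [_ [z [pz zy ->]] h] := sup_adherent (half_pow_gt0 n) hs.
    by exists z; split=> //; rewrite -lerBlDr; exact: ltW.
  have [z hz] := choice ex.
  have pz n : bl_pos (z n) by have [] := hz n.
  have zy n : z n <=: y n by have [] := hz n.
  have wz : weakly_null z by exact: weakly_null_le wy.
  have dz : pairwise_disjoint z.
    move=> n k nk; rewrite !bl_abs_id //.
    exact: bl_inf_disj_le (pz n) (pz k) (zy n) (zy k) (dy _ _ nk).
  have /norm_nullP uz := uDP z dz wz.
  apply: null_seq_le (null_seqD uz half_pow_null) => n.
  rewrite ger0_norm; first by have [] := hz n.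
  by apply: le_trans (normr_ge0 (u 0)) _; apply: (q_ge); [exact: bl_pos0 | exact: py].
apply/norm_nullP; apply: null_seq_le (seminorm_null q_mono qD qZ qC q_disj px xM wx) => n.
by rewrite normr_id; apply: (q_ge); [exact: px | exact: bl_lexx].
Qed.

(** * Positive multilinear operators *)

Section Multilinear.
Variables (m : nat) (E : 'I_m -> BanachLattice) (G : BanachLattice).
Implicit Types (x y : forall i, E i) (T : (forall i, E i) -> G).

Lemma dupd_same x (i : 'I_m) (v : E i) : dupd x v i = v.
Proof.
rewrite /dupd; case: eqP => [e|//].
by rewrite (Prop_irrelevance e erefl).
Qed.

Lemma dupd_other x (i j : 'I_m) (v : E i) : i <> j -> dupd x v j = x j.
Proof. by rewrite /dupd; case: eqP. Qed.

Lemma dupd_ext x y (i : 'I_m) (v : E i) : y i = v -> (forall j, i <> j -> y j = x j) ->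
  dupd x v = y.
Proof.
move=> yi yj; apply: functional_extensionality_dep => j.
have [ij|/eqP ij] := eqVneq i j; first by case: _ / ij; rewrite dupd_same.
by rewrite dupd_other // yj.
Qed.

Lemma dupd_id x (i : 'I_m) : dupd x (x i) = x.
Proof. exact: dupd_ext. Qed.

Lemma dupd_pos x (i : 'I_m) (v : E i) : bl_pos v -> (forall j, i <> j -> bl_pos (x j)) ->
  forall j, bl_pos (dupd x v j).
Proof.
move=> pv px j; have [ij|/eqP ij] := eqVneq i j; first by case: _ / ij; rewrite dupd_same.
by rewrite dupd_other //; exact: px.
Qed.

Variable T : (forall i, E i) -> G.
Hypothesis Tl : multilinear T.

Lemma multilinearD x (i : 'I_m) (v w : E i) : T (dupd x (v + w)) = T (dupd x v) + T (dupd x w).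
Proof. by have := Tl x 1 v w; rewrite !scale1r. Qed.

Lemma multilinear0 x (i : 'I_m) : T (dupd x (0 : E i)) = 0.
Proof. by have := Tl x (-1) (0 : E i) 0; rewrite !scaleN1r oppr0 addr0 addNr. Qed.

Lemma multilinearZ x (i : 'I_m) (a : RR) (v : E i) : T (dupd x (a *: v)) = a *: T (dupd x v).
Proof. by have := Tl x a v 0; rewrite multilinear0 !addr0. Qed.

Lemma multilinearB x (i : 'I_m) (v w : E i) : T (dupd x (v - w)) = T (dupd x v) - T (dupd x w).
Proof. by rewrite multilinearD -scaleN1r multilinearZ scaleN1r. Qed.

Lemma multilinear_scale (c : 'I_m -> RR) x :
  T (fun i => c i *: x i) = (\prod_(i < m) c i) *: T x.
Proof.
pose z (s : seq 'I_m) := fun i => (if i \in s then c i else 1) *: x i.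
have zE s : uniq s -> T (z s) = (\prod_(i <- s) c i) *: T x.
  elim: s => [_|k s IH /= /andP[ks us]].
    by rewrite big_nil scale1r; congr T; apply: functional_extensionality_dep => i;
      rewrite /z in_nil scale1r.
  rewrite big_cons -scalerA -IH //.
  have -> : z (k :: s) = dupd (z s) (c k *: x k).
    apply/esym/dupd_ext; first by rewrite /z inE eqxx.
    by move=> j kj; rewrite /z inE eq_sym; case: eqP.
  rewrite multilinearZ; congr (_ *: T _); apply: dupd_ext => //.
  by rewrite /z (negPf ks) scale1r.
rewrite -zE ?index_enum_uniq //; congr T; apply: functional_extensionality_dep => i.
by rewrite /z mem_index_enum.
Qed.

Hypothesis Tp : positive_multi T.

Lemma positive_multi_mono x y : (forall i, bl_pos (x i)) -> (forall i, x i <=: y i) ->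
  T x <=: T y.
Proof.
move=> px xy; pose z (s : seq 'I_m) := fun i => if i \in s then y i else x i.
have pz s i : bl_pos (z s i).
  by rewrite /z; case: ifP => // _; exact: bl_le_trans (px i) (xy i).
have zle s : T x <=: T (z s).
  elim: s => [|k s IH]; first exact: bl_lexx.
  apply: bl_le_trans IH _.
  have -> : z (k :: s) = dupd (z s) (y k).
    apply/esym/dupd_ext; first by rewrite /z inE eqxx.
    by move=> j kj; rewrite /z inE eq_sym; case: eqP.
  rewrite -{1}(dupd_id (z s) k); apply/bl_subr_ge0; rewrite -multilinearB; apply: Tp.
  apply: dupd_pos => //; apply/bl_subr_ge0; rewrite /z.
  by case: ifP => // _; exact: bl_lexx.
have -> : y = z (index_enum 'I_m); last exact: zle.
by apply: functional_extensionality_dep => i; rewrite /z mem_index_enum.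
Qed.

Lemma positive_multi_abs x : T x <=: T (fun i => bl_abs (x i)) /\
  - T x <=: T (fun i => bl_abs (x i)).
Proof.
(* Induction on the number of leading coordinates of unknown sign: the last of these is split into
   positive and negative parts. *)
have key k : forall y, (forall i : 'I_m, (k <= i)%N -> bl_pos (y i)) ->
    T y <=: T (fun i => bl_abs (y i)) /\ - T y <=: T (fun i => bl_abs (y i)).
  elim: k => [|k IH] y py.
    have -> : (fun i => bl_abs (y i)) = y.
      by apply: functional_extensionality_dep => i; rewrite bl_abs_id //; exact: py.
    have Ty : bl_pos (T y) by apply: Tp => i; exact: py.
    split; first exact: bl_lexx.
    by apply: (bl_le_of_sub (bl_leD Ty Ty)); module.
  have [mk|km] := leqP m k.
    by apply: IH => i ki; have := ltn_ord i; rewrite ltnNge (leq_trans mk ki).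
  pose i := Ordinal km; pose y' := fun i => bl_abs (y i).
  have h v : bl_pos v -> T (dupd y (v : E i)) <=: T (dupd y' v) /\
      - T (dupd y (v : E i)) <=: T (dupd y' v).
    move=> pv.
    have -> : dupd y' v = (fun j => bl_abs (dupd y v j)).
      apply: dupd_ext; first by rewrite dupd_same bl_abs_id.
      by move=> j ij; rewrite dupd_other.
    apply: IH => j kj; have [ij|/eqP ij] := eqVneq i j.
      by case: _ / ij; rewrite dupd_same.
    rewrite dupd_other //; apply: py; rewrite ltn_neqAle kj andbT.
    by apply/eqP => e; apply: ij; apply: val_inj.
  have [a1 a2] := h _ (bl_pp_pos (y i)); have [b1 b2] := h _ (bl_pp_pos (- y i)).
  have -> : T (fun j => bl_abs (y j)) = T (dupd y' (bl_pp (y i))) + T (dupd y' (bl_pp (- y i))).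
    by rewrite -multilinearD -bl_absE -/y' dupd_id.
  have -> : T y = T (dupd y (bl_pp (y i))) - T (dupd y (bl_pp (- y i))).
    by rewrite -multilinearB bl_pp_subN dupd_id.
  split; first by apply: (bl_le_of_sub (bl_leD a1 b2)); module.
  by apply: (bl_le_of_sub (bl_leD a2 b1)); module.
by apply: (key m) => i; rewrite leqNgt ltn_ord.
Qed.

(** If [T] were unbounded, there would be positive tuples with coordinates of norm $2^{-n}$ and
    values of norm above $n$. By completeness one tuple [X] dominates them all, and monotonicity
    makes the norm of [T X] exceed every $n$. *)
Lemma positive_multi_bounded : exists c, multi_bounded_by T c.
Proof.
apply: contrapT => nb.
have ex n : exists y : forall i, E i,
    [/\ forall i, bl_pos (y i), forall i, `|y i| = 2^-1 ^+ n & n%:R < `|T y|].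
  (* Rescaling each coordinate to norm $2^{-n}$ multiplies [T x] by $2^{-nm} / \prod \|x_i\|$, which
     turns the bound with this [c] into exactly $n$. *)
  pose c : RR := n%:R / 2^-1 ^+ n ^+ m.
  have [x hx] : exists x, c * \prod_(i < m) `|x i| < `|T x|.
    apply: contrapT => h; apply: nb; exists c => x; rewrite leNgt; apply/negP => hx.
    by apply: h; exists x.
  have x0 i : 0 < `|x i|.
    rewrite normr_gt0; apply/eqP => xi; move: hx.
    rewrite (bigD1 i) //= xi normr0 mul0r mulr0.
    by rewrite -(dupd_id x i) xi multilinear0 normr0 ltxx.
  pose a i := 2^-1 ^+ n / `|x i|.
  have a0 i : 0 < a i by apply: divr_gt0 => //; exact: half_pow_gt0.
  exists (fun i => a i *: bl_abs (x i)); split=> [i|i|].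
  - by apply: bl_posZ; [exact: ltW | exact: bl_abs_pos].
  - by rewrite normrZ bl_norm_abs ger0_norm ?ltW // /a divfK ?gt_eqF.
  rewrite multilinear_scale normrZ ger0_norm; last by apply: prodr_ge0 => i _; exact: ltW.
  have pa : 0 < \prod_(i < m) a i by apply: prodr_gt0 => i _.
  apply: (@lt_le_trans _ _ (\prod_(i < m) a i * `|T x|)); last first.
    rewrite ler_pM2l //.
    have [h1 h2] := positive_multi_abs x.
    rewrite -(bl_norm_abs (T x)); apply: bl_norm_le; first exact: bl_abs_pos.
    exact: bl_sup_least.
  have -> : n%:R = \prod_(i < m) a i * (c * \prod_(i < m) `|x i|).
    rewrite /a prodf_div prodr_const card_ord /c.
    have p0 : 0 < \prod_(i < m) `|x i| by apply: prodr_gt0 => i _.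
    have q0 : 0 < (2^-1 ^+ n ^+ m : RR) by apply: exprn_gt0; exact: half_pow_gt0.
    move: p0 q0; move: (\prod_(i < m) _) (_ ^+ m) => p r p0 r0.
    by field; rewrite !gt_eqF.
  by rewrite ltr_pM2l.
have [y hy] := choice ex.
have exX i : exists X : E i, forall n, y n i <=: X.
  apply: (@bl_dominating _ _ 1) => n; have [h1 h2 _] := hy n; first exact: h1.
  by rewrite h2 mul1r.
pose X i := projT1 (cid (exX i)).
have yX n i : y n i <=: X i by rewrite /X; case: cid.
have bound n : n%:R < `|T X|.
  have [h1 _ h3] := hy n; apply: lt_le_trans h3 _; apply: bl_norm_le; first exact: Tp.
  exact: positive_multi_mono.
have := archi_boundP (normr_ge0 (T X)).
by move/lt_trans => /(_ _ (bound _)); rewrite ltxx.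
Qed.

End Multilinear.

Lemma multilinear_cst0 (m : nat) (E : 'I_m -> BanachLattice) (G : BanachLattice) :
  multilinear (fun _ : forall i, E i => 0 : G).
Proof. by move=> x i a y z; rewrite scaler0 addr0. Qed.

(** * The tensor product *)

Lemma tensor_lift (m : nat) (E : 'I_m -> BanachLattice) (P : BanachLattice)
  (tens : (forall i, E i) -> P) (hP : is_pos_proj_tensor tens)
  (G : BanachLattice) (T : (forall i, E i) -> G) : regular_multi T ->
  exists L1 L2 : P -> G,
    [/\ [/\ is_linear L1, continuous L1 & positive_op L1],
        [/\ is_linear L2, continuous L2 & positive_op L2] &
        forall x, L1 (tens x) - L2 (tens x) = T x].
Proof.
move=> [_ [_ [A [B [Al Ap Bl Bp TE]]]]]; have [_ _ _ lift _] := hP.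
have [L1 [l1 c1 p1 e1 _]] := lift _ _ Al Ap (positive_multi_bounded Al Ap).
have [L2 [l2 c2 p2 e2 _]] := lift _ _ Bl Bp (positive_multi_bounded Bl Bp).
by exists L1, L2; split=> // x; rewrite e1 e2 TE.
Qed.

Lemma linear_continuousB (U V : normedModType RR) (f g : U -> V) :
  is_linear f -> continuous f -> is_linear g -> continuous g ->
  is_linear (fun x => f x - g x) /\ continuous (fun x => f x - g x).
Proof.
move=> fl fc gl gc; split; first by move=> a x y; rewrite fl gl; module.
by move=> x; apply: cvgB; [exact: fc | exact: gc].
Qed.

Lemma pos_functional_comp (E F : BanachLattice) (L : E -> F) (h : F -> RR) :
  is_linear L -> continuous L -> positive_op L -> pos_functional h ->
  pos_functional (fun x => h (L x)).
Proof.
move=> Ll Lc Lp [hl hp [c hc]]; split=> [a x y|x px|].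
- by rewrite Ll hl.
- by apply: hp; exact: Lp.
have [d d0 hd] := linear_continuous_is_bounded Ll Lc.
exists (`|c| * d) => x; apply: le_trans (hc _) _.
apply: (@le_trans _ _ (`|c| * `|L x|)); first by apply: ler_wpM2r => //; exact: ler_norm.
by rewrite -mulrA; apply: ler_wpM2l.
Qed.

(** If [x] is not norm null, terms of norm at least [e] can be normalised to [y], still weakly null
    because the factors are at most $1/e$. Boundedness is thus built in, and [almost_DP_pos] applied
    to [L1 y] and [L2 y] sends these unit vectors to 0. *)
Lemma positive_Schur_factor (P H : BanachLattice) (u : H -> P) (L1 L2 : P -> H) :
  is_linear u -> continuous u -> almost_DP u ->
  is_linear L1 -> continuous L1 -> positive_op L1 ->
  is_linear L2 -> continuous L2 -> positive_op L2 ->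
  (forall z, u (L1 z - L2 z) = z) -> positive_Schur P.
Proof.
move=> ul uc uDP l1 c1 p1 l2 c2 p2 uL x px wx; apply/norm_nullP; apply: contrapT => nx.
have [e e0 he] := not_null_seq (fun n => normr_ge0 (x n)) nx.
have ex n : exists k, (n <= k)%N /\ e <= `|x k|.
  by have [k nk ek] := he n; exists k; split=> //; exact: ltnW.
have [s hs] := choice ex.
have xs0 n : 0 < `|x (s n)| by have [_] := hs n; exact: lt_le_trans.
pose y n := `|x (s n)|^-1 *: x (s n).
have py n : bl_pos (y n) by apply: bl_posZ => //; rewrite invr_ge0.
have ny n : `|y n| = 1.
  by rewrite normrZ ger0_norm ?invr_ge0 // mulVf // gt_eqF.
have hy h : pos_functional h -> null_seq (fun n => h (y n)).
  move=> hp; have s_ge n : (n <= s n)%N by have [] := hs n.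
  have := null_seqZ e^-1 (null_seq_sub s_ge (weakly_null_pos_functional wx hp)).
  have [hl hpos _] := hp.
  apply: null_seq_le => n; rewrite functionalZ //.
  have hx := hpos _ (px (s n)).
  rewrite ger0_norm; last by apply: mulr_ge0 => //; rewrite invr_ge0.
  by apply: ler_wpM2r => //; rewrite lef_pV2 ?posrE //; have [] := hs n.
have key L : is_linear L -> continuous L -> positive_op L ->
    null_seq (fun n => `|u (L (y n))|).
  move=> Ll Lc Lp; apply/norm_nullP.
  have [d d0 hd] := linear_continuous_is_bounded Ll Lc.
  apply: (almost_DP_pos ul uc uDP (x := fun n => L (y n)) (M := d)) => [n|n|].
  - exact: Lp.
  - by have := hd (y n); rewrite ny mulr1.
  apply: weakly_null_of_pos_functional => [n|h hp]; first exact: Lp.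
  exact: hy (pos_functional_comp Ll Lc Lp hp).
have [N hN] := null_seqD (key L1 l1 c1 p1) (key L2 l2 c2 p2) ltr01.
have := le_lt_trans (ler_norm _) (hN N (leqnn N)).
apply/negP; rewrite -leNgt -{1}(ny N) -{1}(uL (y N)) is_linearB //.
exact: ler_normB.
Qed.

Theorem theorem2p1 (m : nat) (hm : (0 < m)%N) (E : 'I_m -> BanachLattice)
  (P : BanachLattice) (tens : (forall i, E i) -> P)
  (hP : is_pos_proj_tensor tens) :
  let c1 := positive_Schur P in
  let c2 := forall (G : BanachLattice) (T : (forall i, E i) -> G),
      regular_multi T ->
      forall Tt : P -> G, is_linear Tt -> continuous Tt ->
        (forall x, Tt (tens x) = T x) -> almost_DP Tt in
  let c3 := forall (G : BanachLattice) (T : (forall i, E i) -> G),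
      regular_multi T ->
      exists (H : BanachLattice) (A : (forall i, E i) -> H) (u : H -> G),
        [/\ regular_multi A, regular_op u, almost_DP u &
            forall x, T x = u (A x)] in
  (c1 <-> c2) /\ (c2 <-> c3).
Proof.
move=> c1 c2 c3; have [tl tp tb _ tuniq] := hP.
have tens_reg : regular_multi tens.
  split=> //; split; first by exists 1.
  exists tens, (fun=> 0); split=> //; first exact: multilinear_cst0.
    by move=> x _; exact: bl_pos0.
  by move=> x; rewrite subr0.
have c12 : c1 -> c2.
  move=> psp G T _ Tt Tl Tc _ x dx wx.
  have [c c0 hc] := linear_continuous_is_bounded Tl Tc.
  (* The moduli are positive and weakly null, and have the same norms as the [x n]. *)
  have /norm_nullP := psp _ (fun n => bl_abs_pos (x n)) (abs_weakly_null dx wx).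
  move/(null_seqZ c) => h; apply/norm_nullP; apply: null_seq_le (h) => n.
  by rewrite normr_id bl_norm_abs.
have c23 : c2 -> c3.
  move=> h2 G T Treg; have [L1 [L2 [[l1 k1 p1] [l2 k2 p2] LE]]] := tensor_lift hP Treg.
  have [ul uc] := linear_continuousB l1 k1 l2 k2.
  (* The factorisation goes through the tensor product itself, by the linearization of [T]. *)
  exists P, tens, (fun z => L1 z - L2 z); split=> //.
    by split=> //; split=> //; exists L1, L2.
  exact: h2 Treg _ ul uc LE.
have c31 : c3 -> c1.
  move=> h3; have [H [A [u [Areg [ul [uc _]] uDP tE]]]] := h3 _ _ tens_reg.
  have [L1 [L2 [[l1 k1 p1] [l2 k2 p2] LE]]] := tensor_lift hP Areg.
  apply: (positive_Schur_factor ul uc uDP l1 k1 p1 l2 k2 p2).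
  have [Ll Lc] := linear_continuousB l1 k1 l2 k2.
  (* Both maps fix the elementary tensors, which determine a continuous linear map. *)
  apply: (tuniq P (fun z => u (L1 z - L2 z)) id).
  - by move=> a x y; rewrite Ll ul.
  - by move=> x; exact: cvg_comp (Lc x) (uc (L1 x - L2 x)).
  - by [].
  - by move=> x; exact: cvg_id.
  - by move=> x; rewrite LE tE.
by split; split=> // h; [exact/c31/c23 | exact/c12/c31].
Qed.
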